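(* Let $(X_0,X_1)$ be a compatible couple and $1\le q<\infty$. Let $b\in SV(0,\infty)$ satisfy $$\int_0^\infty t^{-1}b^{q}(t)\,dt<\infty .$$ Let $\beta\in SV(0,\infty)$ be such that $$\int_x^\infty t^{-1}\beta^q(t)\,dt<\infty\ \text{ for all } x>0,\qquad \int_0^\infty t^{-1}\beta^q(t)\,dt=\infty,$$ let $B\in SV(0,\infty)$ be given by $$B(x):=b(x)\ \text{ if } x\in[1,\infty),\qquad B(x)\approx\beta(x)\ \text{ if } x\in(0,1),$$ and put $$A(x):=B^{-q/q'}(x)\int_x^\infty t^{-1}B^q(t)\,dt\quad\text{for all } x>0$$ (so $A(x)=\int_x^\infty t^{-1}B(t)\,dt$ if $q=1$). Then $$(X_0,X_1)_{0,q,b;K}=(X_0,X_1)_{0,q,b;K;(1,\infty)},$$ $$(X_0,X_0+X_1)_{0,q,B;K}=(X_0,X_0+X_1)_{0,q,B;K;(1,\infty)},$$ $$(X_0,X_0+X_1)_{0,q,A;J}=(X_0,X_0+X_1)_{0,q,A;J;(1,\infty)}.$$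
   Context: A pair $(Y_0,Y_1)$ of Banach spaces is a compatible couple if there is a Hausdorff topological vector space in which both are continuously embedded. $Y_0\cap Y_1$ carries the norm $\max\{\|f\|_{Y_0},\|f\|_{Y_1}\}$ and $Y_0+Y_1$ the norm $\inf\{\|f_0\|_{Y_0}+\|f_1\|_{Y_1}: f=f_0+f_1\}$. For $t>0$, $$K(f,t;Y_0,Y_1):=\inf\{\|f_0\|_{Y_0}+t\|f_1\|_{Y_1}: f=f_0+f_1,\ f_0\in Y_0,\ f_1\in Y_1\}\quad (f\in Y_0+Y_1),$$ $$J(f,t;Y_0,Y_1):=\max\{\|f\|_{Y_0},t\|f\|_{Y_1}\}\quad (f\in Y_0\cap Y_1).$$ For $1\le q\le\infty$, $\|\cdot\|_{q,(c,d)}$ is the $L_q$-norm on $(c,d)$, $1/q+1/q'=1$, and $1/\infty=0$. For an interval $I=(0,\infty)$ or $I=(1,\infty)$ and a weight $v$ define: - the $K$-space on $I$: all $f\in Y_0+Y_1$ with $\|t^{-1/q}v(t)K(f,t;Y_0,Y_1)\|_{q,I}<\infty$, this expression being the norm; - the $J$-space on $I$: all $f\in Y_0+Y_1$ for which there is a strongly measurable $u:I\to Y_0\cap Y_1$ with $f=\int_I u(s)\,\frac{ds}{s}$ (convergence in $Y_0+Y_1$) and for which $\inf\|t^{-1/q}v(t)J(u(t),t;Y_0,Y_1)\|_{q,I}$ is finite, the infimum (which is the norm of $f$) being over all such representations of $f$. For $I=(0,\infty)$ these are denoted $(Y_0,Y_1)_{0,q,v;K}$ and $(Y_0,Y_1)_{0,q,v;J}$;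 for $I=(1,\infty)$ they are denoted $(Y_0,Y_1)_{0,q,v;K;(1,\infty)}$ and $(Y_0,Y_1)_{0,q,v;J;(1,\infty)}$. Equality of two spaces means that they are equal as sets and their norms are equivalent. For non-negative expressions, $\mathcal A\approx\mathcal B$ means that each is bounded by a positive constant multiple of the other, the constants being independent of the significant quantities (here, of $x$). $SV(0,\infty)$ is the set of slowly varying functions: positive, finite, Lebesgue-measurable functions $b$ on $(0,\infty)$ such that for each $\varepsilon>0$, $t^{\varepsilon}b(t)$ is equivalent ($\approx$) to a non-decreasing function on $(0,\infty)$ and $t^{-\varepsilon}b(t)$ is equivalent to a non-increasing function on $(0,\infty)$. *)

(* Defs.v *)
Set Warnings "-notation-incompatible-prefix,-notation-overridden".
From HB Require Import structures.
From mathcomp Require Import all_boot all_order all_algebra.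
From mathcomp Require Import all_classical all_reals all_analysis.
Set Implicit Arguments.
Unset Strict Implicit.
Unset Printing Implicit Defensive.
Import Order.TTheory GRing.Theory Num.Theory.
Import numFieldNormedType.Exports.
Local Open Scope classical_set_scope.
Local Open Scope ring_scope.

(* The real line with its Lebesgue (not only Borel) measurable sets; the domain
   of [completed_lebesgue_measure]. *)
Notation lebesgueTypeR R := (caratheodory_type ((@wlength R idfun)^*)%mu).

(* A linear subspace of Z with its own norm. Values of [nrm] outside [carrier]
   are irrelevant; [nrm] is extended real so that infima and L_q-norms can be
   used as they are. *)
Record nspace (R : realType) (Z : lmodType R) := NSpace {
  carrier : set Z;
  nrm : Z -> \bar R }.

Section spaces.
Context {R : realType} {Z : lmodType R}.
Implicit Types (Y : nspace Z) (f : Z) (t : R).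

(* For injective [i] the infimum is over at most one point: the norm of [i x]
   is the norm of [x]. *)
Definition embedded_space (X : normedModType R) (i : X -> Z) : nspace Z :=
  NSpace (range i)
    (fun f => ereal_inf [set (`|x|)%:E | x in [set x | i x = f]]).

Definition decompositions Y0 Y1 f : set (Z * Z) :=
  [set p | [/\ carrier Y0 p.1, carrier Y1 p.2 & f = p.1 + p.2]].

Definition sum_space Y0 Y1 : nspace Z :=
  NSpace [set f | exists p, decompositions Y0 Y1 f p]
    (fun f => ereal_inf
       [set (nrm Y0 p.1 + nrm Y1 p.2)%E | p in decompositions Y0 Y1 f]).

Definition cap_space Y0 Y1 : nspace Z :=
  NSpace (carrier Y0 `&` carrier Y1) (fun f => maxe (nrm Y0 f) (nrm Y1 f)).

Definition Kfun Y0 Y1 f t : \bar R :=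
  ereal_inf
    [set (nrm Y0 p.1 + t%:E * nrm Y1 p.2)%E | p in decompositions Y0 Y1 f].

Definition Jfun Y0 Y1 f t : \bar R := maxe (nrm Y0 f) (t%:E * nrm Y1 f)%E.

(* Equal as sets, with equivalent norms. *)
Definition eq_nspace Y Y' :=
  carrier Y = carrier Y' /\
  exists c C : R, [/\ 0 < c, 0 < C & forall f, carrier Y f ->
    (nrm Y f <= c%:E * nrm Y' f)%E /\ (nrm Y' f <= C%:E * nrm Y f)%E].

(* Y-valued simple functions on I with support of finite measure, given as
   finite sums of terms 1_E c. *)
Record stepfun Y (I : set (lebesgueTypeR R)) := StepFun {
  step_size : nat;
  step_set : 'I_step_size -> set (lebesgueTypeR R);
  step_val : 'I_step_size -> Z;
  step_setP : forall k, [/\ measurable (step_set k), step_set k `<=` I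
                          & (completed_lebesgue_measure (step_set k) < +oo)%E];
  step_valP : forall k, carrier Y (step_val k) }.
Arguments step_set {Y I} s k.
Arguments step_val {Y I} s k.

Definition step_eval Y I (s : stepfun Y I) (t : lebesgueTypeR R) : Z :=
  \sum_(k < step_size s) (\1_(step_set s k) t : R) *: step_val s k.

Definition step_int Y I (s : stepfun Y I) : Z :=
  \sum_(k < step_size s)
    fine (completed_lebesgue_measure (step_set s k)) *: step_val s k.

Definition strongly_measurable Y (I : set (lebesgueTypeR R))
    (u : lebesgueTypeR R -> Z) :=
  (forall t, I t -> carrier Y (u t)) /\
  exists s : nat -> stepfun Y I,
    {ae completed_lebesgue_measure, forall t, I t ->
       nrm Y (u t - step_eval (s n) t) @[n --> \oo] --> 0%E}.

(* [u] is Bochner integrable over [I] (Lebesgue measure) as a [Y]-valued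
   function, with integral [f]. *)
Definition has_bochner_integral Y (I : set (lebesgueTypeR R))
    (u : lebesgueTypeR R -> Z) f :=
  [/\ strongly_measurable Y I u, carrier Y f &
      exists s : nat -> stepfun Y I,
        (\int[completed_lebesgue_measure]_(t in I)
           nrm Y (u t - step_eval (s n) t))%E
           @[n --> \oo] --> 0%E /\
        nrm Y (f - step_int (s n)) @[n --> \oo] --> 0%E].

End spaces.

Section interpolation_spaces.
Context {R : realType} {Z : lmodType R}.
Variables (q : R) (v : R -> R) (I : set (lebesgueTypeR R)).

Definition Lq_norm (g : lebesgueTypeR R -> \bar R) : \bar R :=
  Lnorm completed_lebesgue_measure q%:E (g \_ I).

Variables (Y0 Y1 : nspace Z).

(* (Y0, Y1)_{0,q,v;K;I} *)
Definition Kspace : nspace Z :=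
  let N f := Lq_norm (fun t => (t `^ (- q^-1) * v t)%:E * Kfun Y0 Y1 f t)%E in
  NSpace [set f | carrier (sum_space Y0 Y1) f /\ (N f < +oo)%E] N.

Definition Jrepresentation (f : Z) (u : lebesgueTypeR R -> Z) :=
  strongly_measurable (cap_space Y0 Y1) I u /\
  has_bochner_integral (sum_space Y0 Y1) I (fun s => (s : R)^-1 *: u s) f.

(* (Y0, Y1)_{0,q,v;J;I}; the infimum is +oo when f has no representation. *)
Definition Jspace : nspace Z :=
  let N f := ereal_inf
    [set Lq_norm (fun t => (t `^ (- q^-1) * v t)%:E * Jfun Y0 Y1 (u t) t)%E
       | u in Jrepresentation f] in
  NSpace [set f | carrier (sum_space Y0 Y1) f /\ (N f < +oo)%E] N.

End interpolation_spaces.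

(* f and g bound each other on D up to positive multiplicative constants. *)
Definition equiv_on (R : realType) (D : set R) (f g : R -> R) :=
  exists c C : R, [/\ 0 < c, 0 < C & forall x, D x ->
    f x <= c * g x /\ g x <= C * f x].

Definition slowly_varying (R : realType) (b : R -> R) :=
  [/\ forall t, 0 < t -> 0 < b t,
      measurable_fun (`]0, +oo[ : set (lebesgueTypeR R))
        (b : lebesgueTypeR R -> R)
    & forall e : R, 0 < e ->
      (exists2 g : R -> R, {in `]0, +oo[ &, {homo g : x y / x <= y}} &
         equiv_on `]0, +oo[ (fun t => t `^ e * b t) g) /\
      (exists2 h : R -> R, {in `]0, +oo[ &, {homo h : x y /~ x <= y}} &
         equiv_on `]0, +oo[ (fun t => t `^ (- e) * b t) h)].

(* Main.v *)
Require Import Defs.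
Set Warnings "-notation-incompatible-prefix,-notation-overridden,-ambiguous-paths".
From HB Require Import structures.
From mathcomp Require Import all_boot all_order all_algebra.
From mathcomp Require Import all_classical all_reals all_analysis.
From mathcomp Require Import measurable_realfun ring.
Import Order.TTheory GRing.Theory Num.Theory.
Import numFieldNormedType.Exports.
Local Open Scope classical_set_scope.
Local Open Scope ring_scope.

(** The two halves of the theorem rest on the same observation: over $(0,1)$ the
    norms carry no information that is not already contained in the part over
    $(1,\infty)$.

    For the $K$-spaces ([Kspace_tail]) this is monotonicity. Since $K(f,\cdot)$ is
    non-decreasing, the part of the norm over $(1,\infty)$ is at least a positive
    multiple of $K(f,1)$. If $t^{-1}b^q(t)$ is integrable on $(0,1)$, then
    $K(f,t)\le K(f,1)$ bounds the part over $(0,1)$ by a multiple of $K(f,1)$. For the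
    ordered couple $(X_0,X_0+X_1)$ one even has $K(f,t)\le tK(f,1)$ on $(0,1)$
    ([Kfun_ordered_le]), and $t^{-1}(tB(t))^q$ is integrable on $(0,1)$ for every
    slowly varying $B$ ([integral_linear_weight]).

    For the $J$-spaces, a representation over $(1,\infty)$ extends by zero
    ([Jspace_extend0]). Conversely, let $f=\int_0^\infty u(s)\,ds/s$. On $(0,2)$ the
    $J$-functional dominates the norm of $X_0$, and Hoelder's inequality gives
    $\int_0^2\|u(s)\|_{X_0}\,ds/s\le C\|t^{-1/q}A(t)J(u(t),t)\|_q$
    ([weighted_hoelder]); for $q>1$ the constant is finite because, with
    $G(x)=\int_x^\infty t^{-1}B^q(t)\,dt$, one has
    $t^{-1}A^{-q'}(t)=t^{-1}B^q(t)G^{-q'}(t)$, whose integral over $(0,2)$ is finite: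
    the set where $G\le y$ has mass at most $y$ for the density $t^{-1}B^q$, and the
    dyadic level sets of $G$ contribute a geometric series
    ([integral_power_of_tail], [tail_sublevel_le]). As $X_0$ is complete,
    $x=\int_0^2u(s)\,ds/s$ exists in $X_0$ as a Bochner integral
    ([bochner_complete]), and it may be spread over $(1,2)$: the function equal to
    $sx$ there and to $u(s)$ on $(2,\infty)$ represents $f$ over $(1,\infty)$
    ([bochner_relocate]), with norm at most a multiple of that of $u$, because $A$
    is bounded on $(1,2)$ ([tail_representation]). *)

(** * Integrals of nonnegative functions and the Lebesgue line *)

(** The integral of a nonnegative function is a supremum over the simple
    functions below it, so that these estimates apply to the functions
    $t\mapsto K(f,t)$ and $t\mapsto J(u(t),t)$ as they stand. *)
Section lower_integral.
Context {d : measure_display} {T : measurableType d} {R : realType}.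
Variable mu : {measure set T -> \bar R}.
Implicit Types (D : set T) (f g : T -> \bar R).
Import HBNNSimple.
Local Open Scope ereal_scope.

Lemma le_ge0_integral D f g : (forall t, D t -> 0 <= f t) ->
  (forall t, D t -> f t <= g t) ->
  \int[mu]_(t in D) f t <= \int[mu]_(t in D) g t.
Proof.
move=> f0 fg; rewrite integral_mkcond [leRHS]integral_mkcond.
have fr0 : forall t, 0 <= (f \_ D) t by apply: erestrict_ge0.
have gr0 : forall t, 0 <= (g \_ D) t.
  by apply: erestrict_ge0 => t Dt; apply: le_trans (f0 _ Dt) (fg _ Dt).
rewrite !ge0_integralTE//; apply: ereal_sup_le => _ [h /= hf <-].
exists h => // t; apply: (le_trans (hf t)); rewrite !patchE.
by case: ifPn => //; rewrite inE => /fg.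
Qed.

Lemma ge0_integral_subset D D' f : D `<=` D' -> (forall t, D' t -> 0 <= f t) ->
  \int[mu]_(t in D) f t <= \int[mu]_(t in D') f t.
Proof.
move=> DD' f0; rewrite integral_mkcond [leRHS]integral_mkcond.
apply: le_ge0_integral => t _; rewrite !patchE.
  by case: ifPn => //; rewrite inE => /DD' /f0.
case: ifPn => [/set_mem/DD' /mem_set ->//|_].
by case: ifPn => // /set_mem /f0.
Qed.

Lemma ge0_integral_setU_le D D' f : measurable D -> measurable D' ->
  (forall t, (D `|` D') t -> 0 <= f t) ->
  \int[mu]_(t in D `|` D') f t
    <= \int[mu]_(t in D) f t + \int[mu]_(t in D') f t.
Proof.
move=> mD mD' f0; rewrite integral_mkcond.
have fr0 : forall t, 0 <= (f \_ (D `|` D')) t by apply: erestrict_ge0.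
rewrite ge0_integralTE//; apply: ge_ereal_sup => _ [h /= hf <-].
have mh E : measurable_fun E (EFin \o h).
  by apply/measurable_EFinP; apply: (measurable_funS measurableT).
have h0 t : 0 <= (h t)%:E by rewrite lee_fin.
have hle E t : E `<=` D `|` D' -> E t -> (h t)%:E <= f t.
  by move=> ED Et; have := hf t; rewrite patchE mem_set//; exact: ED.
have -> : sintegral mu h = \int[mu]_(t in D `|` D') (h t)%:E.
  rewrite integral_mkcond -integralT_nnsfun; apply: eq_integral => t _.
  rewrite patchE; case: ifPn => // /negP tD.
  apply/eqP; rewrite eq_le h0 andbT; have := hf t.
  by rewrite patchE memNset// => Dt; apply: tD; rewrite inE.
rewrite -(setDUK (@subsetUl _ D D')) ge0_integral_setU//; last 2 first.
- by apply: measurableD => //; exact: measurableU.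
- by rewrite disj_set2E setDIK.
apply: leeD.
  by apply: le_ge0_integral => // t Dt; apply: (hle D) => //; exact: subsetUl.
apply: (@le_trans _ _ (\int[mu]_(t in D') (h t)%:E)).
  apply: ge0_integral_subset => // t [[//|//] nD].
by apply: le_ge0_integral => // t Dt; apply: (hle D') => //; exact: subsetUr.
Qed.

Lemma ge0_integral_gt0 D f : measurable D -> 0 < mu D ->
  (exists2 c : R, (0 < c)%R & forall t, D t -> c%:E <= f t) ->
  0 < \int[mu]_(t in D) f t.
Proof.
move=> mD muD [c c0 cf]; apply: (@lt_le_trans _ _ (c%:E * mu D)).
  by rewrite mule_gt0.
rewrite -integral_cst//; apply: le_ge0_integral => // t _.
by rewrite lee_fin ltW.
Qed.

Lemma ge0_integral_fineK D f : (forall t, D t -> 0 <= f t) ->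
  \int[mu]_(t in D) f t < +oo ->
  (fine (\int[mu]_(t in D) f t))%:E = \int[mu]_(t in D) f t.
Proof. by move=> f0 fi; rewrite fineK// ge0_fin_numE// integral_ge0. Qed.

Lemma fine_integral_ge0 D f : (forall t, D t -> 0 <= f t) ->
  (0 <= fine (\int[mu]_(t in D) f t))%R.
Proof. by move=> f0; rewrite fine_ge0// integral_ge0. Qed.

End lower_integral.

Section lebesgue_line.
Context {R : realType}.
Notation L := (lebesgueTypeR R).
Notation mu := (@completed_lebesgue_measure R).

Lemma borel_lebesgue_measurable (D : set (measurableTypeR R)) :
  measurable D -> measurable (D : set L).
Proof. exact: sub_caratheodory. Qed.

Lemma itv_lebesgue_measurable (i : interval R) : measurable ([set` i] : set L).
Proof. by apply: borel_lebesgue_measurable; exact: measurable_itv. Qed.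

Lemma borel_lebesgue_measurable_fun d (U : measurableType d) (D : set R)
    (f : R -> U) : measurable D -> measurable_fun D f ->
  measurable_fun (D : set L) (f : L -> U).
Proof.
by move=> mD mf _ Y mY; apply: (@borel_lebesgue_measurable (D `&` f @^-1` Y)); exact: mf.
Qed.

Lemma measurable_powR_lebesgue (r : R) (D : set L) :
  measurable_fun D (fun t : L => (t : R) `^ r).
Proof.
apply: measurable_funTS.
apply: (borel_lebesgue_measurable_fun _ _ setT (fun t : R => t `^ r)).
  exact: measurableT.
exact: measurable_powR.
Qed.

Lemma completed_lebesgue_measure_itv (i : interval R) :
  (mu ([set` i] : set L) = (if i.1 < i.2 then (i.2 : \bar R) - i.1 else 0))%E.
Proof. exact: (lebesgue_measure_itv i). Qed.

End lebesgue_line.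

(** * Seminormed subspaces, sums, intersections and the $K$-functional *)

Section ereal_inf_estimates.
Context {R : realType}.
Local Open Scope ereal_scope.
Implicit Types (S : set (\bar R)) (y : \bar R).

Lemma le_scaled_ereal_inf S y (k : R) : (0 < k)%R ->
  (forall x, S x -> y <= k%:E * x) -> y <= k%:E * ereal_inf S.
Proof.
move=> k0 h; rewrite -lee_pdivrMl//; apply: le_ereal_inf_tmp => x Sx.
by rewrite lee_pdivrMl//; exact: h.
Qed.

Lemma le_add_ereal_inf S S' y :
  ereal_inf S \is a fin_num -> ereal_inf S' \is a fin_num ->
  (forall a b, S a -> S' b -> y <= a + b) ->
  y <= ereal_inf S + ereal_inf S'.
Proof.
move=> fS fS' h; apply/lee_addgt0Pr => e e0.
have e20 : (0 < e / 2)%R by rewrite divr_gt0.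
have [a Sa ale] := lb_ereal_inf_adherent e20 fS.
have [b Sb ble] := lb_ereal_inf_adherent e20 fS'.
apply: (le_trans (h _ _ Sa Sb)); apply: (le_trans (leeD (ltW ale) (ltW ble))).
by rewrite addeACA -EFinD -splitr.
Qed.

End ereal_inf_estimates.

Section seminormed_spaces.
Context {R : realType} {Z : lmodType R}.
Implicit Types Y : nspace Z.
Local Open Scope ereal_scope.

(** The axioms of a seminorm on the carrier: they pass to sums and
    intersections, so that every space of the theorem satisfies them. *)
Record seminormed Y : Prop := Seminormed {
  carrier0 : carrier Y 0%R;
  carrierD : forall f g, carrier Y f -> carrier Y g -> carrier Y (f + g)%R;
  carrierZ : forall (a : R) f, carrier Y f -> carrier Y (a *: f)%R;
  nrm_ge0 : forall f, 0 <= nrm Y f;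
  nrm_fin : forall f, carrier Y f -> nrm Y f \is a fin_num;
  ler_nrmD : forall f g, carrier Y f -> carrier Y g ->
    nrm Y (f + g)%R <= nrm Y f + nrm Y g;
  ler_nrmZ : forall (a : R) f, carrier Y f ->
    nrm Y (a *: f)%R <= `|a|%R%:E * nrm Y f }.

Lemma carrierN {Y} : seminormed Y -> forall f, carrier Y f -> carrier Y (- f)%R.
Proof. by move=> sY f Yf; rewrite -scaleN1r; exact: carrierZ. Qed.

Lemma carrierB {Y} : seminormed Y -> forall f g,
  carrier Y f -> carrier Y g -> carrier Y (f - g)%R.
Proof. by move=> sY f g Yf Yg; apply: carrierD => //; exact: carrierN. Qed.

Lemma nrm0 {Y} : seminormed Y -> nrm Y 0%R = 0.
Proof.
move=> sY; apply/eqP; rewrite eq_le nrm_ge0// andbT.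
have := ler_nrmZ _ sY 0%R 0%R (carrier0 _ sY).
by rewrite scale0r normr0 mul0e.
Qed.

Lemma nrmN {Y} : seminormed Y -> forall f, carrier Y f -> nrm Y (- f)%R = nrm Y f.
Proof.
move=> sY f Yf; have le g : carrier Y g -> nrm Y (- g)%R <= nrm Y g.
  move=> Yg; have := ler_nrmZ _ sY (-1)%R g Yg.
  by rewrite scaleN1r normrN1 mul1e.
apply/eqP; rewrite eq_le le//= -[leLHS]/(nrm Y f) -{1}(opprK f) le//.
exact: carrierN.
Qed.

Lemma nrmZ {Y} : seminormed Y -> forall (a : R) f, carrier Y f ->
  nrm Y (a *: f)%R = `|a|%R%:E * nrm Y f.
Proof.
move=> sY a f Yf; have [->|a0] := eqVneq a 0%R.
  by rewrite scale0r nrm0// normr0 mul0e.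
apply/eqP; rewrite eq_le ler_nrmZ//=.
have na0 : (0 < `|a|)%R by rewrite normr_gt0.
rewrite -lee_pdivlMl// -normfV -{1}(scalerK a0 f).
by apply: ler_nrmZ => //; exact: carrierZ.
Qed.

Lemma nrmB_sym {Y} : seminormed Y -> forall f g, carrier Y f -> carrier Y g ->
  nrm Y (f - g)%R = nrm Y (g - f)%R.
Proof.
by move=> sY f g Yf Yg; rewrite -opprB nrmN//; exact: carrierB.
Qed.

Lemma ler_nrm_via {Y} : seminormed Y -> forall f g, carrier Y f -> carrier Y g ->
  nrm Y f <= nrm Y g + nrm Y (f - g)%R.
Proof.
move=> sY f g Yf Yg; rewrite -{1}(subrKC g f); apply: ler_nrmD => //.
exact: carrierB.
Qed.

Lemma carrier_sum {Y} : seminormed Y -> forall n (c : 'I_n -> Z),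
  (forall k, carrier Y (c k)) -> carrier Y (\sum_(k < n) c k)%R.
Proof.
move=> sY n c Yc; elim/big_ind: _ => //; first exact: carrier0.
by move=> f g; exact: carrierD.
Qed.

Lemma nrm_embedded (X : normedModType R) (i : {linear X -> Z}) :
  injective i -> forall x, nrm (embedded_space i) (i x) = `|x|%:E.
Proof.
move=> inj_i x /=; rewrite [X in ereal_inf X](_ : _ = [set `|x|%:E]).
  by rewrite ereal_inf1.
by apply/seteqP; split => [_ [y /inj_i -> <-]//|_ ->]; exists x.
Qed.

Lemma embedded_seminormed (X : normedModType R) (i : {linear X -> Z}) :
  injective i -> seminormed (embedded_space i).
Proof.
move=> inj_i; have nE := nrm_embedded X i inj_i; split.
- by exists 0%R => //; rewrite linear0.
- by move=> _ _ [x _ <-] [y _ <-]; exists (x + y)%R => //; rewrite linearD.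
- by move=> a _ [x _ <-]; exists (a *: x)%R => //; rewrite linearZ.
- by move=> f; apply: le_ereal_inf_tmp => _ [x _ <-]; rewrite lee_fin.
- by move=> _ [x _ <-]; rewrite nE.
- move=> _ _ [x _ <-] [y _ <-]; rewrite -linearD !nE -EFinD lee_fin.
  exact: ler_normD.
- by move=> a _ [x _ <-]; rewrite -linearZ !nE -EFinM normrZ.
Qed.

Lemma sum_seminormed Y0 Y1 : seminormed Y0 -> seminormed Y1 ->
  seminormed (sum_space Y0 Y1).
Proof.
move=> s0 s1.
have ge0 f : 0 <= nrm (sum_space Y0 Y1) f.
  by apply: le_ereal_inf_tmp => _ [p _ <-]; rewrite adde_ge0//; exact: nrm_ge0.
have le_dec f p : decompositions Y0 Y1 f p ->
    nrm (sum_space Y0 Y1) f <= nrm Y0 p.1 + nrm Y1 p.2.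
  by move=> fp; apply: ereal_inf_lbound; exists p.
have fin f : carrier (sum_space Y0 Y1) f -> nrm (sum_space Y0 Y1) f \is a fin_num.
  move=> [p fp]; rewrite ge0_fin_numE//.
  apply: (le_lt_trans (le_dec _ _ fp)); case: fp => Yp1 Yp2 _.
  by rewrite lte_add_pinfty// ltey_eq (@nrm_fin Y0, @nrm_fin Y1).
have decD f g p p' : decompositions Y0 Y1 f p -> decompositions Y0 Y1 g p' ->
    decompositions Y0 Y1 (f + g)%R (p.1 + p'.1, p.2 + p'.2)%R.
  move=> [? ? ->] [? ? ->]; split => /=; [exact: carrierD|exact: carrierD|].
  by rewrite addrACA.
have decZ a f p : decompositions Y0 Y1 f p ->
    decompositions Y0 Y1 (a *: f)%R (a *: p.1, a *: p.2)%R.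
  move=> [? ? ->]; split => /=; [exact: carrierZ|exact: carrierZ|].
  by rewrite scalerDr.
split => //.
- by exists (0, 0)%R; split => /=; [exact: carrier0|exact: carrier0|rewrite addr0].
- move=> f g [p fp] [p' gp']; eexists; exact: decD fp gp'.
- move=> a f [p fp]; eexists; exact: decZ fp.
- move=> f g Yf Yg; apply: le_add_ereal_inf; [exact: fin|exact: fin|].
  move=> _ _ [p fp <-] [p' gp' <-]; apply: (le_trans (le_dec _ _ (decD _ _ _ _ fp gp'))).
  rewrite /= addeACA; case: fp => ? ? _; case: gp' => ? ? _.
  by apply: leeD; exact: ler_nrmD.
- move=> a f [p0 fp0]; have [->|a0] := eqVneq a 0%R.
    rewrite scale0r normr0 mul0e; apply: (le_trans (le_dec _ (0, 0)%R _)).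
      by split => /=; [exact: carrier0|exact: carrier0|rewrite addr0].
    by rewrite /= !nrm0// adde0.
  apply: le_scaled_ereal_inf; first by rewrite normr_gt0.
  move=> _ [p fp <-]; apply: (le_trans (le_dec _ _ (decZ a _ _ fp))) => /=.
  rewrite ge0_muleDr; [|exact: nrm_ge0|exact: nrm_ge0].
  by case: fp => ? ? _; apply: leeD; exact: ler_nrmZ.
Qed.

Lemma cap_seminormed Y0 Y1 : seminormed Y0 -> seminormed Y1 ->
  seminormed (cap_space Y0 Y1).
Proof.
move=> s0 s1; split.
- by split; exact: carrier0.
- by move=> f g [? ?] [? ?]; split; exact: carrierD.
- by move=> a f [? ?]; split; exact: carrierZ.
- by move=> f; rewrite /= le_max nrm_ge0.
- move=> f [Y0f Y1f] /=; have := nrm_fin _ s0 _ Y0f; have := nrm_fin _ s1 _ Y1f.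
  by case: leP.
- move=> f g [? ?] [? ?] /=; rewrite ge_max; apply/andP; split.
    apply: (le_trans (ler_nrmD _ s0 _ _ _ _)) => //.
    by apply: leeD; rewrite le_max lexx.
  apply: (le_trans (ler_nrmD _ s1 _ _ _ _)) => //.
  by apply: leeD; rewrite le_max lexx orbT.
- move=> a f [? ?] /=; rewrite ge_max; apply/andP; split.
    apply: (le_trans (ler_nrmZ _ s0 _ _ _)) => //.
    by apply: lee_wpmul2l; rewrite ?lee_fin// le_max lexx.
  apply: (le_trans (ler_nrmZ _ s1 _ _ _)) => //.
  by apply: lee_wpmul2l; rewrite ?lee_fin// le_max lexx orbT.
Qed.

(** Inclusion with norm at most one. *)
Definition subspace_of Y Y' :=
  carrier Y `<=` carrier Y' /\ forall f, carrier Y f -> nrm Y' f <= nrm Y f.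

Lemma sub_sum_l Y0 Y1 : seminormed Y1 -> subspace_of Y0 (sum_space Y0 Y1).
Proof.
move=> s1; have dec f : carrier Y0 f -> decompositions Y0 Y1 f (f, 0%R).
  by move=> Yf; split => //=; [exact: carrier0|rewrite addr0].
split => [f Yf|f Yf]; first by eexists; exact: dec.
apply: ereal_inf_lbound; exists (f, 0%R); first exact: dec.
by rewrite /= nrm0// adde0.
Qed.

Lemma sub_cap_l Y0 Y1 : subspace_of (cap_space Y0 Y1) Y0.
Proof. by split => [f []//|f _ /=]; rewrite le_max lexx. Qed.

Lemma subspace_of_trans Y Y' Y'' :
  subspace_of Y Y' -> subspace_of Y' Y'' -> subspace_of Y Y''.
Proof.
move=> [YY' nYY'] [Y'Y'' nY'Y'']; split => [|f Yf]; first exact: subset_trans Y'Y''.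
by apply: (le_trans _ (nYY' _ Yf)); apply: nY'Y''; exact: YY'.
Qed.

End seminormed_spaces.

Section K_functional.
Context {R : realType} {Z : lmodType R}.
Variables Y0 Y1 : nspace Z.
Hypotheses (s0 : seminormed Y0) (s1 : seminormed Y1).
Local Open Scope ereal_scope.

Lemma Kfun_ge0 f (t : R) : (0 <= t)%R -> 0 <= Kfun Y0 Y1 f t.
Proof.
move=> t0; apply: le_ereal_inf_tmp => _ [p _ <-].
by rewrite adde_ge0 ?mule_ge0 ?lee_fin//; exact: nrm_ge0.
Qed.

Lemma Kfun_homo f (t t' : R) : (t <= t')%R ->
  Kfun Y0 Y1 f t <= Kfun Y0 Y1 f t'.
Proof.
move=> tt'; apply: le_ereal_inf_tmp => _ [p fp <-].
apply: (@le_trans _ _ (nrm Y0 p.1 + t%:E * nrm Y1 p.2)).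
  by apply: ereal_inf_lbound; exists p.
by apply: leeD => //; apply: lee_wpmul2r; [exact: nrm_ge0|rewrite lee_fin].
Qed.

End K_functional.

(** In the ordered couple $(Y_0, Y_0+Y_1)$ the whole of $f$ may be put into the
    larger space, which is optimal up to $t = 1$; hence the $K$-functional is
    dominated by a linear function there. *)
Lemma Kfun_ordered_le {R : realType} {Z : lmodType R} (Y0 Y1 : nspace Z) f (t : R) :
  seminormed Y0 -> seminormed Y1 -> (0 <= t)%R ->
  carrier (sum_space Y0 (sum_space Y0 Y1)) f ->
  (Kfun Y0 (sum_space Y0 Y1) f t
    <= t%:E * Kfun Y0 (sum_space Y0 Y1) f 1)%E.
Proof.
move=> s0 s1 t0 Yf; have ss := sum_seminormed _ _ s0 s1.
have [sub01 n01] := sub_sum_l Y0 Y1 s1.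
have Sf : carrier (sum_space Y0 Y1) f.
  by case: Yf => p [/sub01 ? ? ->]; exact: carrierD.
apply: (@le_trans _ _ (t%:E * nrm (sum_space Y0 Y1) f)%E).
  apply: ereal_inf_lbound; exists (0%R, f); last by rewrite /= nrm0// add0e.
  by split => //=; [exact: carrier0|rewrite add0r].
apply: lee_wpmul2l; first by rewrite lee_fin.
apply: le_ereal_inf_tmp => _ [p [Yp1 Sp2 ->] <-]; rewrite mul1e.
apply: (le_trans (ler_nrmD _ ss _ _ (sub01 _ Yp1) Sp2)).
by apply: leeD => //; exact: n01.
Qed.

(** * $L_q$-norms and $K$-spaces over $(1,\infty)$ *)

Section Lq_norms.
Context {R : realType}.
Notation L := (lebesgueTypeR R).
Notation mu := (@completed_lebesgue_measure R).
Local Open Scope ereal_scope.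
Implicit Types (I : set L) (g : L -> \bar R) (q : R).

Lemma Lq_normE q I g : (0 < q)%R -> (forall t, I t -> 0 <= g t) ->
  Lq_norm q I g = (\int[mu]_(t in I) (g t `^ q)) `^ q^-1.
Proof.
move=> q0 g0; rewrite /Lq_norm unlock [in RHS]integral_mkcond.
congr (_ `^ _); apply: eq_integral => t _; rewrite /= !patchE.
case: ifPn => [/set_mem It|_]; first by rewrite gee0_abs// g0.
by rewrite abse0 poweR0r// gt_eqF.
Qed.

Lemma Lq_norm_ge0 q I g : 0 <= Lq_norm q I g.
Proof. exact: Lnorm_ge0. Qed.

Lemma Lq_norm_le_scale q I I' g g' (C : R) : (0 < q)%R -> (0 <= C)%R ->
  (forall t, I t -> 0 <= g t) -> (forall t, I' t -> 0 <= g' t) ->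
  \int[mu]_(t in I') (g' t `^ q) <= C%:E * \int[mu]_(t in I) (g t `^ q) ->
  Lq_norm q I' g' <= (C `^ q^-1)%:E * Lq_norm q I g.
Proof.
move=> q0 C0 g0 g'0 h; rewrite !Lq_normE// -poweR_EFin -poweRM; last 2 first.
- by rewrite lee_fin.
- by apply: integral_ge0 => t _; exact: poweR_ge0.
apply: gt0_ler_poweR h; first by rewrite invr_ge0 ltW.
- by rewrite in_itv/= leey andbT integral_ge0// => t _; exact: poweR_ge0.
- rewrite in_itv/= leey andbT mule_ge0// ?lee_fin//.
  by rewrite integral_ge0// => t _; exact: poweR_ge0.
Qed.

Lemma weighted_poweR q (v : R -> R) (t : R) (x : \bar R) : (0 < q)%R ->
  (0 < t)%R -> (0 <= v t)%R -> 0 <= x ->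
  ((t `^ (- q^-1) * v t)%:E * x) `^ q = (t^-1 * v t `^ q)%:E * x `^ q.
Proof.
move=> q0 t0 v0 x0; rewrite poweRM//; last first.
  by rewrite lee_fin mulr_ge0// powR_ge0.
congr (_ * _); rewrite poweR_EFin powRM ?powR_ge0// -powRrM.
by rewrite mulNr mulVf ?gt_eqF// powR_inv1// ltW.
Qed.

Lemma le_poweR q (x y : \bar R) : (0 <= q)%R -> 0 <= x -> x <= y ->
  x `^ q <= y `^ q.
Proof.
move=> q0 x0 xy; apply: gt0_ler_poweR => //.
- by rewrite in_itv/= x0 leey.
- by rewrite in_itv/= (le_trans x0 xy) leey.
Qed.

End Lq_norms.

Section K_spaces.
Context {R : realType} {Z : lmodType R}.
Notation L := (lebesgueTypeR R).
Notation mu := (@completed_lebesgue_measure R).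
Variables (q : R) (v h : R -> R) (Y0 Y1 : nspace Z).
Hypotheses (q1 : 1 <= q) (s0 : seminormed Y0) (s1 : seminormed Y1).

(** The $K$-functional is monotone in $t$, so $K(f,1)$ is controlled by the part of the
    norm over $(1,\infty)$, while by hypothesis it controls the part over
    $(0,1)$. *)
Lemma Kspace_tail :
  (forall t : R, 0 < t -> 0 < v t) -> (forall t : R, 0 < t -> 0 <= h t) ->
  measurable_fun (`]0%R, 1%R]%classic : set L)
    (fun t : L => t^-1 * (v t * h t) `^ q) ->
  measurable_fun (`]1%R, +oo[%classic : set L) (fun t : L => t^-1 * v t `^ q) ->
  (\int[mu]_(t in (`]0%R, 1%R]%classic : set L))
     ((t : R)^-1 * (v t * h t) `^ q)%:E < +oo)%E ->
  (0 < \int[mu]_(t in (`]1%R, +oo[%classic : set L)) ((t : R)^-1 * v t `^ q)%:E)%E ->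
  (forall f (t : R), carrier (sum_space Y0 Y1) f -> 0 < t <= 1 ->
     (Kfun Y0 Y1 f t <= (h t)%:E * Kfun Y0 Y1 f 1)%E) ->
  eq_nspace (Kspace q v `]0, +oo[ Y0 Y1) (Kspace q v `]1, +oo[ Y0 Y1).
Proof.
move=> v0 h0 mvh mv ivh iv Kh.
have q0 : 0 < q by apply: lt_le_trans q1.
pose g f (t : L) := ((t `^ (- q^-1) * v t)%:E * Kfun Y0 Y1 f t)%E.
have g0 f t : (`]0, +oo[%classic : set L) t -> (0 <= g f t)%E.
  rewrite /= in_itv/= andbT => t0; apply: mule_ge0; last exact/Kfun_ge0/ltW.
  by rewrite lee_fin mulr_ge0 ?powR_ge0// ltW// v0.
have sub1 : (`]1, +oo[%classic : set L) `<=` `]0, +oo[.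
  by move=> t /=; rewrite !in_itv/= !andbT; exact: lt_trans.
have g1 f t : (`]1, +oo[%classic : set L) t -> (0 <= g f t)%E by move=> /sub1/g0.
have gE f (t : L) : 0 < t ->
    (g f t `^ q = (t^-1 * v t `^ q)%:E * Kfun Y0 Y1 f t `^ q)%E.
  by move=> t0; rewrite weighted_poweR ?Kfun_ge0// ltW// v0.
have [m m0 mle] : exists2 m : R, 0 < m & (m%:E <= \int[mu]_(t in (`]1%R, +oo[%classic : set L))
     ((t : R)^-1 * v t `^ q)%:E)%E.
  move: iv; case: (integral _ _ _) => [r r0|_|//]; first by exists r.
  by exists 1; rewrite ?leey.
pose M := fine (\int[mu]_(t in (`]0%R, 1%R]%classic : set L))
     ((t : R)^-1 * (v t * h t) `^ q)%:E)%E.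
have w0 (t : L) : (`]0%R, 1%R]%classic : set L) t -> 0 <= t^-1 * (v t * h t) `^ q.
  by rewrite /= in_itv/= => /andP[t0 _]; rewrite mulr_ge0 ?powR_ge0// invr_ge0 ltW.
have ME : (M%:E = \int[mu]_(t in (`]0%R, 1%R]%classic : set L))
     ((t : R)^-1 * (v t * h t) `^ q)%:E)%E.
  apply: ge0_integral_fineK; last exact: ivh.
  by move=> t t01; rewrite lee_fin; exact: w0.
have M0 : 0 <= M.
  by apply: fine_integral_ge0 => t t01; rewrite lee_fin; exact: w0.
have low f : carrier (sum_space Y0 Y1) f ->
    (m%:E * Kfun Y0 Y1 f 1 `^ q <= \int[mu]_(t in (`]1%R, +oo[%classic : set L)) (g f t `^ q))%E.
  move=> Yf; apply: (@le_trans _ _ (\int[mu]_(t in (`]1%R, +oo[%classic : set L))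
     (((t : R)^-1 * v t `^ q)%:E * Kfun Y0 Y1 f 1 `^ q))%E).
    rewrite ge0_integralZr; first last.
    - exact: poweR_ge0.
    - move=> t /sub1 /=; rewrite in_itv/= andbT => t0.
      by rewrite lee_fin mulr_ge0 ?powR_ge0// invr_ge0 ltW.
    - exact/measurable_EFinP.
    - exact: itv_lebesgue_measurable.
    by apply: lee_wpmul2r => //; exact: poweR_ge0.
  apply: le_ge0_integral => t /= t1; have := sub1 _ t1; rewrite /= in_itv/= andbT => t0.
    by rewrite mule_ge0 ?poweR_ge0// lee_fin mulr_ge0 ?powR_ge0// invr_ge0 ltW.
  rewrite gE//; apply: lee_wpmul2l.
    by rewrite lee_fin mulr_ge0 ?powR_ge0// invr_ge0 ltW.
  apply: le_poweR; [exact: ltW|exact: Kfun_ge0|apply: Kfun_homo => //].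
  by move: t1; rewrite in_itv/= andbT => /ltW.
have high f : carrier (sum_space Y0 Y1) f ->
    (\int[mu]_(t in (`]0%R, 1%R]%classic : set L)) (g f t `^ q) <= M%:E * Kfun Y0 Y1 f 1 `^ q)%E.
  move=> Yf; rewrite ME -ge0_integralZr; first last.
  - exact: poweR_ge0.
  - by move=> t t01; rewrite lee_fin; exact: w0.
  - exact/measurable_EFinP.
  - exact: itv_lebesgue_measurable.
  apply: le_ge0_integral => t t01; first exact: poweR_ge0.
  have /andP[t0 t1] : 0 < t <= 1 by move: t01; rewrite /= in_itv.
  rewrite gE// powRM ?h0 ?v0//; last exact/ltW/v0.
  rewrite mulrA [in leRHS]EFinM -muleA; apply: lee_wpmul2l.
    by rewrite lee_fin mulr_ge0 ?powR_ge0// invr_ge0 ltW.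
  rewrite -poweR_EFin -poweRM ?lee_fin ?h0// ?Kfun_ge0//.
  by apply: le_poweR; [exact: ltW|exact/Kfun_ge0/ltW|apply: Kh; rewrite ?t0].
have cut : (`]0, +oo[%classic : set L) = `]0%R, 1%R] `|` `]1%R, +oo[.
  apply/seteqP; split => t /=; rewrite !in_itv/= !andbT.
    by move=> t0; case: (leP t 1) => t1; [left; rewrite t0|right].
  by move=> [/andP[]//|]; exact: lt_trans.
have tail f : carrier (sum_space Y0 Y1) f ->
    (\int[mu]_(t in (`]0%R, +oo[%classic : set L)) (g f t `^ q) <=
      (M / m + 1)%:E * \int[mu]_(t in (`]1%R, +oo[%classic : set L)) (g f t `^ q))%E.
  move=> Yf; rewrite cut.
  apply: (le_trans (ge0_integral_setU_le mu (`]0%R, 1%R]%classic : set L) (`]1%R, +oo[%classic : set L) _ _ _ _)).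
  - exact: itv_lebesgue_measurable.
  - exact: itv_lebesgue_measurable.
  - by move=> t _; exact: poweR_ge0.
  rewrite EFinD ge0_muleDl; [|by rewrite lee_fin divr_ge0// ltW|exact: lee01].
  rewrite mul1e; apply: leeD => //; apply: (le_trans (high _ Yf)).
  rewrite EFinM -muleA; apply: lee_wpmul2l; first by rewrite lee_fin.
  by rewrite lee_pdivlMl//; exact: low.
have le01 f : (Lq_norm q `]1%R, +oo[ (g f) <= Lq_norm q `]0%R, +oo[ (g f))%E.
  have := @Lq_norm_le_scale R q `]0%R, +oo[%classic `]1%R, +oo[%classic (g f) (g f) 1 q0 ler01 (g0 f) (g1 f).
  rewrite powR1 !mul1e; apply; apply: ge0_integral_subset => // t _.
  exact: poweR_ge0.
pose C := (M / m + 1) `^ q^-1.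
have C0 : 0 < C by rewrite powR_gt0// ltr_wpDl// divr_ge0// ltW.
have le10 f : carrier (sum_space Y0 Y1) f ->
    (Lq_norm q `]0%R, +oo[ (g f) <= C%:E * Lq_norm q `]1%R, +oo[ (g f))%E.
  move=> Yf; apply: Lq_norm_le_scale; [exact: q0| |exact: g1|exact: g0|exact: tail].
  by rewrite addr_ge0// divr_ge0// ltW.
split.
  apply/seteqP; split => f /= [Yf Nf]; split => //.
    by apply: le_lt_trans Nf; exact: le01.
  apply: (le_lt_trans (le10 f Yf)); rewrite lte_mul_pinfty// lee_fin; exact: ltW.
exists C, 1; split => // f [Yf _]; split; first exact: le10.
by rewrite mul1e; exact: le01.
Qed.

End K_spaces.

(** * Step functions and their integrals *)

Section step_functions.
Context {R : realType} {Z : lmodType R}.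
Notation L := (lebesgueTypeR R).
Notation mu := (@completed_lebesgue_measure R).
Implicit Types (Y : nspace Z) (I D E : set L) (phi psi : L -> Z) (z : Z).

(** Step functions are only needed up to the representation as a sum: this
    predicate keeps the function and the integral. *)
Definition is_step Y I phi z :=
  exists2 s : stepfun Y I, step_eval s = phi & step_int s = z.

Let sub_lty D E : measurable D -> measurable E -> D `<=` E ->
  (mu E < +oo)%E -> (mu D < +oo)%E.
Proof. by move=> mD mE DE; apply: le_lt_trans; apply: le_measure; rewrite ?inE. Qed.

Lemma fine_measure_split D E : measurable D -> measurable E ->
  (mu D < +oo)%E -> fine (mu D) = fine (mu (D `&` E)) + fine (mu (D `\` E)).
Proof.
move=> mD mE fD; rewrite (measureDI mu mD mE) addrC fineD//.
- rewrite ge0_fin_numE//; apply: sub_lty fD; [|exact: mD|exact: subIsetl].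
  exact: measurableI.
- rewrite ge0_fin_numE//; apply: sub_lty fD; [|exact: mD|exact: subDsetl].
  exact: measurableD.
Qed.

Lemma is_step_weaken Y Y' I I' phi z : carrier Y `<=` carrier Y' -> I `<=` I' ->
  is_step Y I phi z -> is_step Y' I' phi z.
Proof.
move=> YY' II' [[n E c mE Yc] <- <-].
have mE' k : [/\ measurable (E k), E k `<=` I' & (mu (E k) < +oo)%E].
  by case: (mE k) => ? EI ?; split => //; exact: subset_trans II'.
by exists (@StepFun _ _ Y' I' n E c mE' (fun k => YY' _ (Yc k))).
Qed.

Lemma is_step_indic Y I E c : measurable E -> E `<=` I -> (mu E < +oo)%E ->
  carrier Y c -> is_step Y I (fun t => (\1_E t : R) *: c) (fine (mu E) *: c).
Proof.
move=> mE EI fE Yc.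
exists (@StepFun _ _ Y I 1 (fun=> E) (fun=> c) (fun=> And3 mE EI fE) (fun=> Yc)).
  by apply/funext => t; rewrite /step_eval big_ord1.
by rewrite /step_int big_ord1.
Qed.

Lemma is_step0 Y I : is_step Y I (fun=> 0) 0.
Proof.
exists (@StepFun _ _ Y I 0 (fun=> set0) (fun=> 0)
  (fun k => False_ind _ (notF (ltn_ord k))) (fun k => False_ind _ (notF (ltn_ord k)))).
  by apply/funext => t; rewrite /step_eval big_ord0.
by rewrite /step_int big_ord0.
Qed.

Lemma is_stepD Y I phi psi z w : is_step Y I phi z -> is_step Y I psi w ->
  is_step Y I (fun t => phi t + psi t) (z + w).
Proof.
move=> [[m E c mE Yc] <- <-] [[n E' c' mE' Yc'] <- <-].
pose F (k : 'I_(m + n)) := match fintype.split k with inl i => E i | inr j => E' j end.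
pose d (k : 'I_(m + n)) := match fintype.split k with inl i => c i | inr j => c' j end.
have mF k : [/\ measurable (F k), F k `<=` I & (mu (F k) < +oo)%E].
  by rewrite /F; case: (fintype.split k).
have Yd k : carrier Y (d k) by rewrite /d; case: (fintype.split k).
have Fl i : F (lshift n i) = E i by rewrite /F -[lshift n i]/(unsplit (inl i)) unsplitK.
have Fr i : F (rshift m i) = E' i by rewrite /F -[rshift m i]/(unsplit (inr i)) unsplitK.
have dl i : d (lshift n i) = c i by rewrite /d -[lshift n i]/(unsplit (inl i)) unsplitK.
have dr i : d (rshift m i) = c' i by rewrite /d -[rshift m i]/(unsplit (inr i)) unsplitK.
exists (@StepFun _ _ Y I (m + n) F d mF Yd).
  apply/funext => t; rewrite /step_eval/= big_split_ord/=.
  by congr (_ + _); apply: eq_bigr => i _; rewrite (Fl, Fr) (dl, dr).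
rewrite /step_int/= big_split_ord/=.
by congr (_ + _); apply: eq_bigr => i _; rewrite (Fl, Fr) (dl, dr).
Qed.

Lemma is_stepZ Y I phi z (a : R) : seminormed Y -> is_step Y I phi z ->
  is_step Y I (fun t => a *: phi t) (a *: z).
Proof.
move=> sY [[n E c mE Yc] <- <-].
exists (@StepFun _ _ Y I n E (fun k => a *: c k) mE (fun k => carrierZ _ sY a _ (Yc k))).
  apply/funext => t; rewrite /step_eval/= scaler_sumr; apply: eq_bigr => k _.
  by rewrite !scalerA mulrC.
rewrite /step_int/= scaler_sumr; apply: eq_bigr => k _.
by rewrite !scalerA mulrC.
Qed.

Lemma is_stepB Y I phi psi z w : seminormed Y ->
  is_step Y I phi z -> is_step Y I psi w ->
  is_step Y I (fun t => phi t - psi t) (z - w).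
Proof.
move=> sY sz sw; have := is_stepD _ _ _ _ _ _ sz (is_stepZ _ _ _ _ (-1) sY sw).
rewrite scaleN1r; congr is_step; apply/funext => t.
by rewrite scaleN1r.
Qed.

Lemma is_step_restrict Y I phi z D : measurable D -> is_step Y I phi z ->
  exists z1 z2, [/\ is_step Y (I `&` D) (fun t => (\1_D t : R) *: phi t) z1,
    is_step Y (I `\` D) (fun t => (\1_(~` D) t : R) *: phi t) z2 & z = z1 + z2].
Proof.
move=> mD [[n E c mE Yc] <- <-].
have mE1 k : [/\ measurable (E k `&` D), E k `&` D `<=` I `&` D
    & (mu (E k `&` D) < +oo)%E].
  case: (mE k) => mEk EI fE; split; [exact: measurableI|exact: setSI|].
  apply: sub_lty fE; [exact: measurableI|exact: mEk|exact: subIsetl].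
have mE2 k : [/\ measurable (E k `\` D), E k `\` D `<=` I `\` D
    & (mu (E k `\` D) < +oo)%E].
  case: (mE k) => mEk EI fE; split; [exact: measurableD|exact: setSD|].
  apply: sub_lty fE; [exact: measurableD|exact: mEk|exact: subDsetl].
do 2 eexists; split.
- exists (@StepFun _ _ Y (I `&` D) n _ c mE1 Yc); last by [].
  apply/funext => t; rewrite /step_eval/= scaler_sumr; apply: eq_bigr => k _.
  by rewrite scalerA indicI mulrC.
- exists (@StepFun _ _ Y (I `\` D) n _ c mE2 Yc); last by [].
  apply/funext => t; rewrite /step_eval/= scaler_sumr; apply: eq_bigr => k _.
  by rewrite scalerA setDE indicI mulrC.
- rewrite /step_int/= -big_split/=; apply: eq_bigr => k _; rewrite -scalerDl.
  by case: (mE k) => mEk EI fE; rewrite -fine_measure_split.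
Qed.

Lemma is_step_out Y I phi z t : is_step Y I phi z -> ~ I t -> phi t = 0.
Proof.
move=> [[n E c mE Yc] <- _] nIt; rewrite /step_eval/= big1// => k _.
by rewrite indicE memNset ?scale0r// => Et; apply: nIt; case: (mE k) => _ + _; exact.
Qed.

Lemma is_step_carrier Y I phi z : seminormed Y -> is_step Y I phi z ->
  (forall t, carrier Y (phi t)) /\ carrier Y z.
Proof.
move=> sY [[n E c mE Yc] <- <-]; split => [t|]; apply: carrier_sum => // k;
  exact: carrierZ.
Qed.

(** The constant a and the set D make the induction on the number of terms go
   through: D is split along the first set of the sum. *)
Let step_sum Y n (E : 'I_n -> set L) (c : 'I_n -> Z) : seminormed Y ->
  (forall k, measurable (E k) /\ (mu (E k) < +oo)%E) ->
  (forall k, carrier Y (c k)) -> forall a, carrier Y a ->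
  measurable_fun setT (fun t => nrm Y (a + \sum_(k < n) (\1_(E k) t : R) *: c k))
  /\ forall D, measurable D -> a = 0 \/ (mu D < +oo)%E ->
  (nrm Y (fine (mu D) *: a + \sum_(k < n) fine (mu (E k `&` D)) *: c k) <=
  \int[mu]_(t in D) nrm Y (a + \sum_(k < n) (\1_(E k) t : R) *: c k))%E.
Proof.
move=> sY; elim: n E c => [|n IH] E c mE Yc a Ya.
  split.
    under eq_fun do rewrite big_ord0 addr0.
    exact: measurable_cst.
  move=> D mD aD; rewrite big_ord0 addr0.
  under eq_integral do rewrite big_ord0 addr0.
  rewrite integral_cst//; case: aD => [->|fD].
    by rewrite scaler0 nrm0// mul0e.
  rewrite (nrmZ sY)// muleC ger0_norm ?fine_ge0// fineK// ge0_fin_numE//.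
have [mE0 fE0] := mE ord0.
have Y0 : carrier Y (a + c ord0) by apply: carrierD.
have [m1 h1] := IH (fun k => E (lift ord0 k)) (fun k => c (lift ord0 k))
  (fun k => mE _) (fun k => Yc _) _ Y0.
have [m2 h2] := IH (fun k => E (lift ord0 k)) (fun k => c (lift ord0 k))
  (fun k => mE _) (fun k => Yc _) _ Ya.
have in0 t : E ord0 t -> a + \sum_(k < n.+1) (\1_(E k) t : R) *: c k =
    a + c ord0 + \sum_(k < n) (\1_(E (lift ord0 k)) t : R) *: c (lift ord0 k).
  by move=> Et; rewrite big_ord_recl indicE mem_set// scale1r addrA.
have out0 t : ~ E ord0 t -> a + \sum_(k < n.+1) (\1_(E k) t : R) *: c k =
    a + \sum_(k < n) (\1_(E (lift ord0 k)) t : R) *: c (lift ord0 k).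
  by move=> Et; rewrite big_ord_recl indicE memNset// scale0r add0r.
have mall : measurable_fun setT
    (fun t => nrm Y (a + \sum_(k < n.+1) (\1_(E k) t : R) *: c k)).
  rewrite -(setUv (E ord0)); apply/measurable_funU.
  - exact: mE0.
  - exact: measurableC.
  split.
    apply: eq_measurable_fun (measurable_funTS m1) => t; rewrite inE => Et.
    by rewrite in0.
  apply: eq_measurable_fun (measurable_funTS m2) => t; rewrite inE => Et.
  by rewrite out0.
split=> // D mD aD.
have mDE : measurable (D `&` E ord0) by exact: measurableI.
have mDE' : measurable (D `\` E ord0) by exact: measurableD.
have fDE : (mu (D `&` E ord0) < +oo)%E.
  by apply: sub_lty fE0; [exact: mDE|exact: mE0|exact: subIsetr].
have fDE' : a = 0 \/ (mu (D `\` E ord0) < +oo)%E.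
  case: aD => [|fD]; [by left|right].
  by apply: sub_lty fD; [exact: mDE'|exact: mD|exact: subDsetl].
have sum1 : carrier Y (fine (mu (D `&` E ord0)) *: (a + c ord0) +
    \sum_(k < n) fine (mu (E (lift ord0 k) `&` (D `&` E ord0))) *: c (lift ord0 k)).
  by apply: carrierD => //; [exact: carrierZ|apply: carrier_sum => // k; exact: carrierZ].
have sum2 : carrier Y (fine (mu (D `\` E ord0)) *: a +
    \sum_(k < n) fine (mu (E (lift ord0 k) `&` (D `\` E ord0))) *: c (lift ord0 k)).
  by apply: carrierD => //; [exact: carrierZ|apply: carrier_sum => // k; exact: carrierZ].
have -> : fine (mu D) *: a + \sum_(k < n.+1) fine (mu (E k `&` D)) *: c k =
    (fine (mu (D `&` E ord0)) *: (a + c ord0) +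
    \sum_(k < n) fine (mu (E (lift ord0 k) `&` (D `&` E ord0))) *: c (lift ord0 k))
    + (fine (mu (D `\` E ord0)) *: a +
    \sum_(k < n) fine (mu (E (lift ord0 k) `&` (D `\` E ord0))) *: c (lift ord0 k)).
  have -> : fine (mu D) *: a =
      fine (mu (D `&` E ord0)) *: a + fine (mu (D `\` E ord0)) *: a.
    case: aD => [->|fD]; first by rewrite !scaler0 addr0.
    by rewrite -scalerDl -fine_measure_split.
  have -> : \sum_(k < n.+1) fine (mu (E k `&` D)) *: c k =
      fine (mu (D `&` E ord0)) *: c ord0 +
      (\sum_(k < n) fine (mu (E (lift ord0 k) `&` (D `&` E ord0))) *: c (lift ord0 k)
      + \sum_(k < n) fine (mu (E (lift ord0 k) `&` (D `\` E ord0))) *: c (lift ord0 k)).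
    rewrite big_ord_recl setIC; congr (_ + _); rewrite -big_split/=.
    apply: eq_bigr => k _; rewrite -scalerDl; congr (_ *: _).
    have [mEk fEk] := mE (lift ord0 k).
    rewrite setIA setIDA; apply: fine_measure_split => //.
      exact: measurableI.
    by apply: sub_lty fEk; [exact: measurableI|exact: mEk|exact: subIsetl].
  by rewrite scalerDr addrACA -[RHS]addrA; congr (_ + _); rewrite addrCA.
apply: (le_trans (ler_nrmD _ sY _ _ sum1 sum2)).
have -> : (\int[mu]_(t in D) nrm Y (a + \sum_(k < n.+1) (\1_(E k) t : R) *: c k) =
    \int[mu]_(t in D `&` E ord0) nrm Y (a + \sum_(k < n.+1) (\1_(E k) t : R) *: c k)
    + \int[mu]_(t in D `\` E ord0) nrm Y (a + \sum_(k < n.+1) (\1_(E k) t : R) *: c k))%E.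
  rewrite -ge0_integral_setU; first last.
  - rewrite disj_set2E; apply/eqP/seteqP; split => // t [[_ ?] [_ ?]] //.
  - by move=> t _; exact: nrm_ge0.
  - exact: (measurable_funTS mall).
  - exact: mDE'.
  - exact: mDE.
  by rewrite setUIDK.
apply: leeD.
  rewrite [leRHS](_ : _ = \int[mu]_(t in D `&` E ord0)
    nrm Y (a + c ord0 + \sum_(k < n) (\1_(E (lift ord0 k)) t : R) *: c (lift ord0 k)))%E.
    by apply: h1 => //; right.
  by apply: eq_integral => t; rewrite inE => -[_ /in0 ->].
rewrite [leRHS](_ : _ = \int[mu]_(t in D `\` E ord0)
    nrm Y (a + \sum_(k < n) (\1_(E (lift ord0 k)) t : R) *: c (lift ord0 k)))%E.
  exact: h2.
by apply: eq_integral => t; rewrite inE => -[_ /out0 ->].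
Qed.

Lemma measurable_nrm_step Y I phi z : seminormed Y -> is_step Y I phi z ->
  measurable_fun setT (fun t => nrm Y (phi t)).
Proof.
move=> sY [[n E c mE Yc] <- _].
have mE' k : measurable (E k) /\ (mu (E k) < +oo)%E by case: (mE k).
have [+ _] := step_sum Y n E c sY mE' Yc 0 (carrier0 _ sY).
by under eq_fun do rewrite add0r.
Qed.

(** The sets of a step function may overlap; they are separated one by one in
    [step_sum], so that the triangle inequality is used on disjoint sets. *)
Lemma nrm_step_int_le Y I phi z : measurable I -> seminormed Y ->
  is_step Y I phi z -> (nrm Y z <= \int[mu]_(t in I) nrm Y (phi t))%E.
Proof.
move=> mI sY [[n E c mE Yc] <- <-].
have mE' k : measurable (E k) /\ (mu (E k) < +oo)%E by case: (mE k).
have [_ /(_ I mI (or_introl erefl))] := step_sum Y n E c sY mE' Yc 0 (carrier0 _ sY).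
rewrite scaler0 add0r; under eq_integral do rewrite add0r.
congr (nrm _ _ <= _)%E; apply: eq_bigr => k _; rewrite setIidl//.
by case: (mE k).
Qed.

Lemma is_step_sum Y I (J : Type) (r : seq J) (phi : J -> L -> Z) (z : J -> Z) :
  (forall j, is_step Y I (phi j) (z j)) ->
  is_step Y I (fun t => \sum_(j <- r) phi j t) (\sum_(j <- r) z j).
Proof.
move=> h; elim: r => [|j r IH].
  rewrite big_nil (_ : (fun=> _) = fun=> 0) ?is_step0//.
  exact: is_step0.
  by apply/funext => t; rewrite big_nil.
rewrite big_cons (_ : (fun=> _) = fun t => phi j t + \sum_(i <- r) phi i t).
  exact: is_stepD.
by apply/funext => t; rewrite big_cons.
Qed.

Import HBSimple.

Lemma is_step_sfun_mul Y I phi z (h : {sfun L >-> R}) : seminormed Y ->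
  is_step Y I phi z -> exists w, is_step Y I (fun t => h t *: phi t) w.
Proof.
move=> sY sphi.
have sy (y : R) : exists w,
    is_step Y I (fun t => y *: ((\1_(h @^-1` [set y]) t : R) *: phi t)) w.
  have mh : measurable (h @^-1` [set y] : set L) by exact: measurable_funPTI.
  have [z1 [_ [s1 _ _]]] := is_step_restrict _ _ _ _ _ mh sphi.
  exists (y *: z1); apply: is_stepZ => //.
  by apply: is_step_weaken s1 => //; exact: subIsetl.
have [w hw] := choice sy.
exists (\sum_(y <- finmap.enum_fset (fset_set (range h))) w y).
rewrite (_ : (fun t => h t *: phi t) = fun t => \sum_(y <- finmap.enum_fset (fset_set (range h)))
   y *: ((\1_(h @^-1` [set y]) t : R) *: phi t)).
  exact: is_step_sum.
apply/funext => t; rewrite {1}fimfunE fsbig_finite//= scaler_suml.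
by apply: eq_bigr => y _; rewrite scalerA.
Qed.

End step_functions.

(** * Strong measurability and Bochner integrals *)

Section vanishing_sequences.
Context {R : realType}.
Local Open Scope ereal_scope.
Implicit Types a b : nat -> \bar R.

Lemma cvge0_le a b : (forall n, 0 <= a n <= b n) ->
  b @ \oo --> 0 -> a @ \oo --> 0.
Proof.
move=> ab b0; apply: (squeeze_cvge _ (cvg_cst _) b0).
by apply: nearW => n; exact: ab.
Qed.

Lemma cvge0D a b : a @ \oo --> 0 -> b @ \oo --> 0 ->
  (fun n => a n + b n) @ \oo --> 0.
Proof. by move=> a0 b0; rewrite -[0]adde0; apply: cvgeD. Qed.

Lemma cvge0Zl a (c : \bar R) : c \is a fin_num -> a @ \oo --> 0 ->
  (fun n => c * a n) @ \oo --> 0.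
Proof. by move=> fc a0; rewrite -(mule0 c); apply: cvgeZl. Qed.

End vanishing_sequences.

Section strong_measurability.
Context {R : realType} {Z : lmodType R}.
Notation L := (lebesgueTypeR R).
Notation mu := (@completed_lebesgue_measure R).
Implicit Types (Y : nspace Z) (I D E : set L) (u phi psi : L -> Z) (z : Z).

Lemma strongly_measurableP Y I u : strongly_measurable Y I u <->
  (forall t, I t -> carrier Y (u t)) /\
  exists2 phi : nat -> L -> Z, (forall n, exists z, is_step Y I (phi n) z) &
    {ae mu, forall t, I t -> nrm Y (u t - phi n t) @[n --> \oo] --> 0%E}.
Proof.
split=> [[Yu [s su]]|[Yu [phi sphi phiu]]]; split => //.
  by exists (fun n => step_eval (s n)) => // n; exists (step_int (s n)); exists (s n).
have [z hz] := choice sphi.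
have /choice[s hs] : forall n, exists s : stepfun Y I, step_eval s = phi n.
  by move=> n; case: (hz n) => s ? _; exists s.
exists s; apply: filterS phiu => t h It.
by under eq_fun do rewrite hs; exact: h.
Qed.

Lemma strongly_measurable_step Y I phi z : seminormed Y -> is_step Y I phi z ->
  strongly_measurable Y I phi.
Proof.
move=> sY sphi; apply/strongly_measurableP; split.
  by move=> t _; have [] := is_step_carrier _ _ _ _ sY sphi.
exists (fun=> phi) => [_|]; first by exists z.
by apply: aeW => t It; rewrite subrr nrm0//; exact: cvg_cst.
Qed.

Lemma strongly_measurable_weaken Y Y' I u : seminormed Y -> seminormed Y' ->
  subspace_of Y Y' -> strongly_measurable Y I u -> strongly_measurable Y' I u.
Proof.
move=> sY sY' [YY' nYY'] /strongly_measurableP[Yu [phi sphi phiu]].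
apply/strongly_measurableP; split; first by move=> t /Yu/YY'.
exists phi => [n|].
  by have [z hz] := sphi n; exists z; apply: is_step_weaken hz.
apply: filterS phiu => t h It; have := h It; apply: cvge0_le => n.
rewrite nrm_ge0//= nYY'//; apply: carrierB => //; first exact: Yu.
by have [z hz] := sphi n; have [] := is_step_carrier _ _ _ _ sY hz.
Qed.

Lemma strongly_measurable_subset Y I D u : measurable D -> D `<=` I ->
  strongly_measurable Y I u -> strongly_measurable Y D u.
Proof.
move=> mD DI /strongly_measurableP[Yu [phi sphi phiu]].
apply/strongly_measurableP; split; first by move=> t /DI/Yu.
exists (fun n t => (\1_D t : R) *: phi n t) => [n|].
  have [z /(is_step_restrict _ _ _ _ _ mD)[z1 [_ [+ _ _]]]] := sphi n.
  by rewrite setIidr//; exists z1.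
apply: filterS phiu => t h Dt; have := h (DI _ Dt).
by rewrite indicE mem_set//; under [in X in _ -> X]eq_fun do rewrite scale1r.
Qed.

Lemma strongly_measurableD Y I u v : seminormed Y ->
  strongly_measurable Y I u -> strongly_measurable Y I v ->
  strongly_measurable Y I (fun t => u t + v t).
Proof.
move=> sY /strongly_measurableP[Yu [phi sphi phiu]].
move=> /strongly_measurableP[Yv [psi spsi psiv]]; apply/strongly_measurableP.
split=> [t It|]; first by apply: carrierD => //; [exact: Yu|exact: Yv].
exists (fun n t => phi n t + psi n t) => [n|].
  have [z hz] := sphi n; have [w hw] := spsi n.
  by exists (z + w); exact: is_stepD.
apply: filterS2 phiu psiv => t h h' It.
apply: (cvge0_le _ _ _ (cvge0D _ _ (h It) (h' It))) => n.
rewrite nrm_ge0//= opprD addrACA; apply: ler_nrmD => //; apply: carrierB => //.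
- exact: Yu.
- by have [z hz] := sphi n; have [] := is_step_carrier _ _ _ _ sY hz.
- exact: Yv.
- by have [z hz] := spsi n; have [] := is_step_carrier _ _ _ _ sY hz.
Qed.

Import HBSimple.

Lemma strongly_measurableZ Y I u (h : L -> R) : seminormed Y -> measurable I ->
  measurable_fun I h -> strongly_measurable Y I u ->
  strongly_measurable Y I (fun t => h t *: u t).
Proof.
move=> sY mI mh /strongly_measurableP[Yu [phi sphi phiu]].
apply/strongly_measurableP; split=> [t It|]; first by apply: carrierZ => //; exact: Yu.
have /measurable_EFinP meh := mh.
have [g gh] := approximation_sfun mI meh.
exists (fun n t => g n t *: phi n t) => [n|].
  by have [z hz] := sphi n; exact: is_step_sfun_mul hz.
have Yphi n t : carrier Y (phi n t).
  by have [z hz] := sphi n; have [] := is_step_carrier _ _ _ _ sY hz.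
apply: filterS phiu => t hu It; have ght := gh _ It; have {}hu := hu It.
have Yut := Yu _ It; have fut := nrm_fin _ sY _ Yut.
have c1 : (fun n => nrm Y (u t) * `|g n t - h t|%:E)%E @ \oo --> 0%E.
  apply: cvge0Zl => //; apply/fine_cvgP; split; first exact: nearW.
  move/fine_cvgP : ght => [_ ght]; rewrite -(normr0 R) -(subrr (h t)).
  by apply: cvg_norm; apply: cvgB => //; exact: cvg_cst.
have c2 : (fun n => `|g n t|%:E * nrm Y (u t - phi n t))%E @ \oo --> 0%E.
  rewrite -(mule0 `|h t|%:E); apply: cvgeM => //.
  apply/fine_cvgP; split; first exact: nearW.
  by move/fine_cvgP : ght => [_ ght]; apply: cvg_norm.
apply: (cvge0_le _ _ _ (cvge0D _ _ c1 c2)) => n.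
rewrite nrm_ge0//=.
have -> : h t *: u t - g n t *: phi n t =
    (h t - g n t) *: u t + g n t *: (u t - phi n t).
  by rewrite scalerBl scalerBr addrA subrK.
have Yd : carrier Y (u t - phi n t) by exact: carrierB.
apply: (le_trans (ler_nrmD _ sY _ _ _ _)).
- exact: carrierZ.
- exact: carrierZ.
by rewrite !nrmZ// distrC muleC.
Qed.

(** The norms of the approximating step functions converge almost everywhere to
    the norm of the limit, and Lebesgue measure is complete. *)
Lemma measurable_nrm Y I u : seminormed Y -> measurable I ->
  strongly_measurable Y I u -> measurable_fun I (fun t => nrm Y (u t)).
Proof.
move=> sY mI /strongly_measurableP[Yu [phi sphi [N [mN N0 subN]]]].
have Yphi n t : carrier Y (phi n t).
  by have [z hz] := sphi n; have [] := is_step_carrier _ _ _ _ sY hz.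
have mIN : measurable (I `\` N) by exact: measurableD.
have cvg_nrm t : (I `\` N) t -> nrm Y (phi n t) @[n --> \oo] --> nrm Y (u t).
  move=> [It Nt].
  have c0 : nrm Y (u t - phi n t) @[n --> \oo] --> 0%E.
    by apply: contrapT => h; apply: Nt; apply: subN => /(_ It).
  have Yut := Yu _ It; have fut := nrm_fin _ sY _ Yut.
  apply: (@squeeze_cvge _ _ _ _ (fun n => nrm Y (u t) - nrm Y (u t - phi n t))%E _
     (fun n => nrm Y (u t) + nrm Y (u t - phi n t))%E).
  - apply: nearW => n; apply/andP; split.
      rewrite leeBlDr ?nrm_fin//; last exact: carrierB.
      exact: ler_nrm_via.
    rewrite nrmB_sym//; exact: ler_nrm_via.
  - rewrite -[X in _ --> X]sube0; apply: cvgeB => //; last exact: cvg_cst.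
    by rewrite oppe0; exact: fin_num_adde_defl.
  - rewrite -[X in _ --> X]adde0; apply: cvgeD => //; last exact: cvg_cst.
    exact: fin_num_adde_defl.
have m1 : measurable_fun (I `\` N) (fun t => nrm Y (u t)).
  apply: (@emeasurable_fun_cvg _ _ _ _ (fun n t => nrm Y (phi n t))) => [n|t].
    have [z hz] := sphi n; apply: measurable_funTS.
    exact: (measurable_nrm_step _ _ _ _ sY hz).
  exact: cvg_nrm.
apply: (@ae_measurable_fun _ _ _ mu completed_lebesgue_measure_is_complete _
   ((fun t => nrm Y (u t)) \_ (I `\` N))).
  exists N; split => // t /= /not_implyP[It nE]; apply: contrapT => Nt; apply: nE.
  by rewrite patchE mem_set.
apply/(measurable_restrict _ mIN mI).
by rewrite setIidr//; exact: subDsetl.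
Qed.

End strong_measurability.

Section bochner.
Context {R : realType} {Z : lmodType R}.
Notation L := (lebesgueTypeR R).
Notation mu := (@completed_lebesgue_measure R).
Implicit Types (Y : nspace Z) (I D E : set L) (u w phi psi : L -> Z) (z : Z).

(** Truncating an approximating step function where its norm exceeds twice the
    norm of the limit brings it no further from the limit and makes it
    dominated, so that the dominated convergence theorem applies. *)
Lemma bochner_approx Y I w : seminormed Y -> measurable I ->
  strongly_measurable Y I w -> (\int[mu]_(t in I) nrm Y (w t) < +oo)%E ->
  exists (phi : nat -> L -> Z) (z : nat -> Z),
    (forall n, is_step Y I (phi n) (z n)) /\
    (\int[mu]_(t in I) nrm Y (w t - phi n t))%E @[n --> \oo] --> 0%E.
Proof.
move=> sY mI smw iw; have mw := measurable_nrm _ _ _ sY mI smw.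
have /strongly_measurableP[Yw [phi sphi phiw]] := smw.
have Yphi n t : carrier Y (phi n t).
  by have [z hz] := sphi n; have [] := is_step_carrier _ _ _ _ sY hz.
pose A n := I `&` [set t | nrm Y (phi n t) - 2%:E * nrm Y (w t) <= 0]%E.
have mA n : measurable (A n).
  have [z hz] := sphi n; apply: (emeasurable_fun_infty_c mI).
  apply: emeasurable_funB.
    by apply: measurable_funTS; exact: (measurable_nrm_step _ _ _ _ sY hz).
  exact: measurable_funeM.
have /choice[z hz] : forall n, exists z,
    is_step Y I (fun t => (\1_(A n) t : R) *: phi n t) z.
  move=> n; have [z /(is_step_restrict _ _ _ _ _ (mA n))[z1 [_ [s1 _ _]]]] := sphi n.
  by exists z1; apply: is_step_weaken s1 => //; exact: subIsetl.
exists (fun n t => (\1_(A n) t : R) *: phi n t), z; split => //.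
have fw t : I t -> nrm Y (w t) \is a fin_num by move=> /Yw; exact: nrm_fin.
have le1 n t : I t -> (nrm Y (w t - (\1_(A n) t : R) *: phi n t)
    <= nrm Y (w t - phi n t))%E.
  move=> It; rewrite indicE; have [_|] := boolP (t \in A n).
    by rewrite scale1r.
  rewrite notin_setE => /not_andP[//|/negP/=].
  rewrite -ltNge sube_gt0 => h; rewrite scale0r subr0.
  have Ywt := Yw _ It.
  rewrite -(leeD2lE _ _ (fw _ It)); apply: (@le_trans _ _ (nrm Y (phi n t))).
    by rewrite -mule2n -mule_natl ltW.
  by rewrite nrmB_sym//; exact: ler_nrm_via.
have le3 n t : I t -> (nrm Y (w t - (\1_(A n) t : R) *: phi n t)
    <= 3%:E * nrm Y (w t))%E.
  move=> It; have Ywt := Yw _ It; have := le1 n t It; rewrite indicE.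
  have [/set_mem[_ /=]|_ _] := boolP (t \in A n).
    rewrite sube_le0 => h _; rewrite scale1r.
    have -> : (3%:E * nrm Y (w t) = nrm Y (w t) + 2%:E * nrm Y (w t))%E.
      rewrite (_ : 3%:E = 1%:E + 2%:E)%E; last by rewrite -EFinD nat1r.
      by rewrite ge0_muleDl// mul1e.
    apply: (le_trans (ler_nrmD _ sY _ _ _ _)) => //; first exact: carrierN.
    by apply: leeD => //; rewrite nrmN.
  rewrite scale0r subr0 lee_pemull ?nrm_ge0//.
  by rewrite lee_fin ler1n.
have mf n : measurable_fun I (fun t => nrm Y (w t - (\1_(A n) t : R) *: phi n t)).
  apply: measurable_nrm => //; rewrite (_ : (fun t => _) =
     (fun t => w t + (-1) *: ((\1_(A n) t : R) *: phi n t))).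
    apply: strongly_measurableD => //.
    exact: (strongly_measurable_step _ _ _ _ sY (is_stepZ _ _ _ _ (-1) sY (hz n))).
  by apply/funext => t; rewrite scaleN1r.
have ig : mu.-integrable I (fun t => 3%:E * nrm Y (w t))%E.
  apply/integrableP; split; first exact: measurable_funeM.
  under eq_integral do rewrite gee0_abs ?mule_ge0 ?nrm_ge0 ?lee_fin//.
  rewrite ge0_integralZl_EFin.
  - by rewrite lte_mul_pinfty.
  - exact: mI.
  - by move=> t _; exact: nrm_ge0.
  - exact: mw.
  - by [].
have f0 : {ae mu, forall t, I t ->
    nrm Y (w t - (\1_(A n) t : R) *: phi n t) @[n --> \oo] --> 0%E}.
  apply: filterS phiw => t h It; apply: (cvge0_le _ _ _ (h It)) => n.
  by rewrite nrm_ge0// le1.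
have fg : {ae mu, forall t n, I t ->
    (`|nrm Y (w t - (\1_(A n) t : R) *: phi n t)| <= 3%:E * nrm Y (w t))%E}.
  by apply: aeW => t n It; rewrite gee0_abs ?nrm_ge0//; exact: le3.
have [_ _] := dominated_convergence mI mf
  (measurable_cst (0 : \bar R)) f0 ig fg.
by rewrite integral0.
Qed.

(** The integrals of approximating step functions form a Cauchy sequence, whose
    limit exists in the complete space. *)
Lemma bochner_complete (X : completeNormedModType R) (i : {linear X -> Z}) I w :
  injective i -> measurable I ->
  let Y := embedded_space i in
  strongly_measurable Y I w -> (\int[mu]_(t in I) nrm Y (w t) < +oo)%E ->
  exists x, [/\ carrier Y x, (nrm Y x <= \int[mu]_(t in I) nrm Y (w t))%E &
  exists (phi : nat -> L -> Z) (z : nat -> Z),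
    [/\ forall n, is_step Y I (phi n) (z n),
    (\int[mu]_(t in I) nrm Y (w t - phi n t))%E @[n --> \oo] --> 0%E &
    nrm Y (x - z n) @[n --> \oo] --> 0%E]].
Proof.
move=> inj_i mI Y smw iw; have sY : seminormed Y by exact: embedded_seminormed.
have [phi [z [hz cphi]]] := bochner_approx _ _ _ sY mI smw iw.
have [Yw _] := smw.
have Yphi n t : carrier Y (phi n t) by have [] := is_step_carrier _ _ _ _ sY (hz n).
have Yz n : carrier Y (z n) by have [] := is_step_carrier _ _ _ _ sY (hz n).
have md n : measurable_fun I (fun t => nrm Y (w t - phi n t)).
  apply: measurable_nrm => //; rewrite (_ : (fun t => _) =
     (fun t => w t + (-1) *: phi n t)).
    apply: strongly_measurableD => //.
    exact: (strongly_measurable_step _ _ _ _ sY (is_stepZ _ _ _ _ (-1) sY (hz n))).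
  by apply/funext => t; rewrite scaleN1r.
have dz n m : (nrm Y (z n - z m) <= \int[mu]_(t in I) nrm Y (w t - phi n t)
    + \int[mu]_(t in I) nrm Y (w t - phi m t))%E.
  apply: (le_trans (nrm_step_int_le _ _ _ _ mI sY (is_stepB _ _ _ _ _ _ sY (hz n) (hz m)))).
  rewrite -ge0_integralD.
  - apply: le_ge0_integral => t It; first exact: nrm_ge0.
    have Ywt := Yw _ It; have Y1 n' : carrier Y (w t - phi n' t) by exact: carrierB.
    rewrite (_ : phi n t - phi m t = - (w t - phi n t) + (w t - phi m t)).
      apply: (le_trans (ler_nrmD _ sY _ _ _ _)) => //; first exact: carrierN.
      by rewrite nrmN.
    by rewrite opprB addrA subrK.
  - exact: mI.
  - by move=> t _; exact: nrm_ge0.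
  - exact: md.
  - by move=> t _; exact: nrm_ge0.
  - exact: md.
have /choice[y yz] : forall n, exists y, i y = z n.
  by move=> n; have [y _ <-] := Yz n; exists y.
have small (e : R) : 0 < e -> \forall n \near \oo,
    (\int[mu]_(t in I) nrm Y (w t - phi n t) < e%:E)%E.
  move=> e0; apply: (cphi [set x | (x < e%:E)%E]); apply: open_nbhs_nbhs; split.
    exact: open_ereal_lt_ereal.
  by rewrite /= lte_fin.
have cy : cvg (y @ \oo).
  apply/cauchy_cvgP/cauchy_exP => e e0.
  have e20 : 0 < e / 2 by rewrite divr_gt0.
  have [N _ hN] := small _ e20.
  exists (y N); exists N => // n /= Nn.
  rewrite -ball_normE /= -lte_fin -(nrm_embedded X i inj_i) linearB !yz.
  apply: (le_lt_trans (dz _ _)); rewrite (splitr e) EFinD.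
  by apply: lteD; apply: hN => /=.
have cx : nrm Y (i (lim (y @ \oo)) - z n) @[n --> \oo] --> 0%E.
  under eq_fun do rewrite -yz -linearB nrm_embedded//.
  apply/fine_cvgP; split; first exact: nearW.
  rewrite -(normr0 X) -(subrr (lim (y @ \oo))).
  by apply: cvg_norm; apply: cvgB => //; exact: cvg_cst.
have Yx : carrier Y (i (lim (y @ \oo))) by exists (lim (y @ \oo)).
exists (i (lim (y @ \oo))); split => //; last by exists phi, z.
have c3 := cvge0D _ _ cphi cx.
have c4 : (fun n => \int[mu]_(t in I) nrm Y (w t) +
    (\int[mu]_(t in I) nrm Y (w t - phi n t) + nrm Y (i (lim (y @ \oo)) - z n)))%E
    @ \oo --> (\int[mu]_(t in I) nrm Y (w t))%E.
  rewrite -[X in _ --> X]adde0; apply: cvgeD => //; last exact: cvg_cst.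
  by rewrite ge0_adde_def// inE// integral_ge0// => t _; exact: nrm_ge0.
apply: (cvge_to_ge c4); apply: nearW => n.
apply: (le_trans (ler_nrm_via sY _ _ Yx (Yz n))); rewrite addeA.
apply: leeD => //; apply: (le_trans (nrm_step_int_le _ _ _ _ mI sY (hz n))).
rewrite -ge0_integralD.
- apply: le_ge0_integral => t It; first exact: nrm_ge0.
  have Ywt := Yw _ It; rewrite nrmB_sym//; exact: ler_nrm_via.
- exact: mI.
- by move=> t _; exact: nrm_ge0.
- exact: measurable_nrm.
- by move=> t _; exact: nrm_ge0.
- exact: md.
Qed.

End bochner.

Section bochner_integral.
Context {R : realType} {Z : lmodType R}.
Notation L := (lebesgueTypeR R).
Notation mu := (@completed_lebesgue_measure R).
Implicit Types (Y : nspace Z) (I D E : set L) (u w phi psi : L -> Z) (z f : Z).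

Lemma has_bochner_integralP Y I w f : has_bochner_integral Y I w f <->
  [/\ strongly_measurable Y I w, carrier Y f &
  exists (phi : nat -> L -> Z) (z : nat -> Z),
    [/\ forall n, is_step Y I (phi n) (z n),
    (\int[mu]_(t in I) nrm Y (w t - phi n t))%E @[n --> \oo] --> 0%E &
    nrm Y (f - z n) @[n --> \oo] --> 0%E]].
Proof.
split=> [[smw Yf [s [cs cf]]]|[smw Yf [phi [z [hz cs cf]]]]]; split => //.
  exists (fun n => step_eval (s n)), (fun n => step_int (s n)); split => // n.
  by exists (s n).
have /choice[s hs] : forall n, exists s : stepfun Y I, step_eval s = phi n /\ step_int s = z n.
  by move=> n; case: (hz n) => s ? ?; exists s.
exists s; split.
  under eq_fun do under eq_integral do rewrite (hs _).1.
  exact: cs.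
by under eq_fun do rewrite (hs _).2.
Qed.

Lemma strongly_measurable_extend0 Y I I' u : seminormed Y -> I `<=` I' ->
  (forall t, ~ I t -> u t = 0) ->
  strongly_measurable Y I u -> strongly_measurable Y I' u.
Proof.
move=> sY II' u0 /strongly_measurableP[Yu [phi sphi phiu]].
apply/strongly_measurableP; split=> [t _|].
  by have [/Yu//|/u0 ->] := pselect (I t); exact: carrier0.
exists phi => [n|].
  by have [z hz] := sphi n; exists z; apply: is_step_weaken hz.
apply: filterS phiu => t h _; have [It|nIt] := pselect (I t); first exact: (h It).
have -> : (fun n => nrm Y (u t - phi n t)) = fun=> 0%E.
  apply/funext => n; have [z hz] := sphi n.
  by rewrite u0// (is_step_out _ _ _ _ _ hz nIt) subr0 nrm0.
exact: cvg_cst.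
Qed.

Lemma has_bochner_integral_extend0 Y I I' w f : seminormed Y -> I `<=` I' ->
  (forall t, ~ I t -> w t = 0) ->
  has_bochner_integral Y I w f -> has_bochner_integral Y I' w f.
Proof.
move=> sY II' w0 /has_bochner_integralP[smw Yf [phi [z [hz cphi cz]]]].
apply/has_bochner_integralP; split => //.
  exact: strongly_measurable_extend0 smw.
exists phi, z; split => // [n|]; first exact: is_step_weaken (hz n).
rewrite (_ : (fun n => _) = fun n => \int[mu]_(t in I) nrm Y (w t - phi n t))%E//.
apply/funext => n; rewrite integral_mkcond [RHS]integral_mkcond.
apply: eq_integral => t _; rewrite !patchE.
have [It|nIt] := pselect (I t); first by rewrite !mem_set//; exact: II'.
rewrite (memNset nIt) w0// (is_step_out _ _ _ _ _ (hz n) nIt) subr0 nrm0//.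
by case: ifP.
Qed.

(** The part of a Bochner integral over $D$ may be replaced by a constant function on a
    subset of measure one of $D$, equal to the value $x$ of that part. Only the
    approximating sequences are compared: the two approximations of the
    integral over $D$ differ by at most the sum of their distances to $w$. *)
Lemma bochner_relocate Y I D E w f x (phi psi : nat -> L -> Z) (z y : nat -> Z) :
  seminormed Y -> measurable I -> measurable D -> measurable E ->
  D `<=` I -> E `<=` D -> mu E = 1%E -> strongly_measurable Y I w ->
  carrier Y x -> carrier Y f ->
  (forall n, is_step Y I (phi n) (z n)) ->
  (\int[mu]_(t in I) nrm Y (w t - phi n t))%E @[n --> \oo] --> 0%E ->
  nrm Y (f - z n) @[n --> \oo] --> 0%E ->
  (forall n, is_step Y D (psi n) (y n)) ->
  (\int[mu]_(t in D) nrm Y (w t - psi n t))%E @[n --> \oo] --> 0%E ->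
  nrm Y (x - y n) @[n --> \oo] --> 0%E ->
  let J := (I `\` D) `|` E in
  exists (phi' : nat -> L -> Z) (z' : nat -> Z),
    [/\ forall n, is_step Y J (phi' n) (z' n),
    (\int[mu]_(t in J)
       nrm Y ((\1_(~` D) t : R) *: w t + (\1_E t : R) *: x - phi' n t))%E
       @[n --> \oo] --> 0%E &
    nrm Y (f - z' n) @[n --> \oo] --> 0%E].
Proof.
move=> sY mI mD mE DI ED muE smw Yx Yf hz cphi cz hy cpsi cy J.
have [Yw _] := smw.
have /choice[zz hzz] : forall n, exists zz : Z * Z, [/\
    is_step Y (I `&` D) (fun t => (\1_D t : R) *: phi n t) zz.1,
    is_step Y (I `\` D) (fun t => (\1_(~` D) t : R) *: phi n t) zz.2 &
    z n = zz.1 + zz.2].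
  move=> n; have [z1 [z2 h]] := is_step_restrict _ _ _ _ _ mD (hz n).
  by exists (z1, z2).
have sE : is_step Y J (fun t => (\1_E t : R) *: x) x.
  have := is_step_indic Y J E x mE (@subsetUr _ _ _).
  by rewrite muE ltry /= scale1r; apply.
exists (fun n t => (\1_(~` D) t : R) *: phi n t + (\1_E t : R) *: x),
  (fun n => (zz n).2 + x); split.
- move=> n; apply: is_stepD => //; have [_ h _] := hzz n.
  by apply: is_step_weaken h => //; exact: subsetUl.
- apply: cvge0_le cphi => n; rewrite integral_ge0/=; last first.
    by move=> t _; exact: nrm_ge0.
  have JI : J `<=` I by move=> t [[]//|/ED/DI].
  apply: (@le_trans _ _ (\int[mu]_(t in J) nrm Y (w t - phi n t))%E); last first.
    by apply: ge0_integral_subset => // t _; exact: nrm_ge0.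
  apply: le_ge0_integral => t Jt; first exact: nrm_ge0.
  rewrite opprD addrACA subrr addr0 -scalerBr.
  have [Dt|nDt] := pselect (D t).
    by rewrite indicE memNset; [rewrite scale0r nrm0// nrm_ge0|by apply].
  by rewrite indicE mem_set// scale1r.
have Yphi n t : carrier Y (phi n t) by have [] := is_step_carrier _ _ _ _ sY (hz n).
have Yz n : carrier Y (z n) by have [] := is_step_carrier _ _ _ _ sY (hz n).
have Ypsi n t : carrier Y (psi n t) by have [] := is_step_carrier _ _ _ _ sY (hy n).
have Yy n : carrier Y (y n) by have [] := is_step_carrier _ _ _ _ sY (hy n).
have hz1 n : is_step Y D (fun t => (\1_D t : R) *: phi n t) (zz n).1.
  by have [+ _ _] := hzz n; rewrite setIidr.
have Yz1 n : carrier Y (zz n).1 by have [] := is_step_carrier _ _ _ _ sY (hz1 n).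
have mwD K (s : L -> Z) v : measurable K -> K `<=` I -> is_step Y K s v ->
    measurable_fun K (fun t => nrm Y (w t - s t)).
  move=> mK KI hs; apply: measurable_nrm => //; rewrite (_ : (fun t => _) =
     (fun t => w t + (-1) *: s t)).
    apply: strongly_measurableD => //; first exact: strongly_measurable_subset smw.
    exact: (strongly_measurable_step _ _ _ _ sY (is_stepZ _ _ _ _ (-1) sY hs)).
  by apply/funext => t; rewrite scaleN1r.
have d1 n : (nrm Y (y n - (zz n).1) <= \int[mu]_(t in I) nrm Y (w t - phi n t) +
    \int[mu]_(t in D) nrm Y (w t - psi n t))%E.
  apply: (le_trans (nrm_step_int_le _ _ _ _ mD sY (is_stepB _ _ _ _ _ _ sY (hy n) (hz1 n)))).
  apply: (@le_trans _ _ (\int[mu]_(t in D) nrm Y (w t - (\1_D t : R) *: phi n t) +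
      \int[mu]_(t in D) nrm Y (w t - psi n t))%E).
    rewrite -ge0_integralD.
    - apply: le_ge0_integral => t Dt; first exact: nrm_ge0.
      have Ywt := Yw _ (DI _ Dt); rewrite indicE mem_set// scale1r.
      rewrite (_ : psi n t - phi n t = (w t - phi n t) - (w t - psi n t)).
        have Yd s : carrier Y s -> carrier Y (w t - s) by exact: carrierB.
        apply: (le_trans (ler_nrmD _ sY _ _ (Yd _ (Yphi n t)) (carrierN sY _ (Yd _ (Ypsi n t))))).
        by rewrite nrmN//; exact: Yd.
      by rewrite opprB [RHS]addrC subrKA.
    - exact: mD.
    - by move=> t _; exact: nrm_ge0.
    - exact: (mwD _ _ _ mD DI (hz1 n)).
    - by move=> t _; exact: nrm_ge0.
    - exact: (mwD _ _ _ mD DI (hy n)).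
  apply: leeD => //.
  rewrite [leLHS](_ : _ = \int[mu]_(t in D) nrm Y (w t - phi n t))%E.
    by apply: ge0_integral_subset => // t _; exact: nrm_ge0.
  by apply: eq_integral => t tD; rewrite indicE tD scale1r.
apply: (cvge0_le _ _ _ (cvge0D _ _ cz (cvge0D _ _ cy (cvge0D _ _ cphi cpsi)))) => n.
rewrite nrm_ge0//=; have [_ _ zE] := hzz n.
have -> : f - ((zz n).2 + x) = (f - z n) + - ((x - y n) + (y n - (zz n).1)).
  by rewrite subrKA zE opprB -addrA !opprD addrACA addNr add0r.
have Y1 : carrier Y (f - z n) by exact: carrierB.
have Y2 : carrier Y (x - y n) by exact: carrierB.
have Y3 : carrier Y (y n - (zz n).1) by exact: carrierB.
have Y4 : carrier Y (x - y n + (y n - (zz n).1)) by exact: carrierD.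
apply: (le_trans (ler_nrmD _ sY _ _ Y1 (carrierN sY _ Y4))).
apply: leeD => //; rewrite nrmN//; apply: (le_trans (ler_nrmD _ sY _ _ Y2 Y3)).
by apply: leeD.
Qed.

End bochner_integral.

(** * Dyadic estimates of integrals *)

Section dyadic_covering.
Context {d : measure_display} {T : measurableType d} {R : realType}.
Variable mu : {measure set T -> \bar R}.
Implicit Types (D : set T).

Lemma dyadic_level (x : R) : 1 <= x -> exists k : nat, 2 ^+ k <= x < 2 ^+ k.+1.
Proof.
move=> x1; have x0 : 0 <= x by apply: le_trans x1.
have exk : exists n : nat, x < 2 ^+ n.
  exists (Num.bound x); apply: (lt_trans (archi_boundP x0)).
  by rewrite -natrX ltr_nat ltn_expl.
have [[|k] xk minn] := ex_minnP exk.
  by move: xk; rewrite expr0 ltNge x1.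
exists k; rewrite xk andbT leNgt; apply/negP => /minn.
by rewrite ltnn.
Qed.

(** At each point $f$ is dominated by one of the $g_k$, hence by their sum. *)
Lemma integral_geometric_cover D (f : T -> \bar R) (g : nat -> T -> \bar R)
    (C z : R) : measurable D -> 0 <= z < 1 ->
  (forall t, D t -> (0 <= f t)%E) ->
  (forall k t, D t -> (0 <= g k t)%E) ->
  (forall k, measurable_fun D (g k)) ->
  (forall t, D t -> exists k, (f t <= g k t)%E) ->
  (forall k, (\int[mu]_(t in D) g k t <= (C * z ^+ k)%:E)%E) ->
  (\int[mu]_(t in D) f t < +oo)%E.
Proof.
move=> mD /andP[z0 z1] f0 g0 mg fg gC.
apply: (@le_lt_trans _ _ (\int[mu]_(t in D) \sum_(k <oo) g k t)%E).
  apply: le_ge0_integral => // t Dt; have [k fk] := fg _ Dt.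
  apply: (le_trans fk); apply: le_trans (nneseries_lim_ge k.+1 _); last first.
    by move=> n _ _; exact: g0.
  rewrite big_nat_recr//= leeDr//; apply: sume_ge0 => n _; exact: g0.
rewrite integral_nneseries//.
have nz : `|z| < 1 by rewrite ger0_norm.
apply: (@le_lt_trans _ _ (\sum_(k <oo) (C * z ^+ k)%:E)%E).
  by apply: lee_nneseries => // k _ _; apply: integral_ge0 => t; exact: g0.
have -> : (\sum_(k <oo) (C * z ^+ k)%:E)%E = (C / (1 - z))%:E; last exact: ltry.
apply/cvg_lim => //.
rewrite (_ : (fun n => _) = EFin \o series (geometric C z)).
  by apply: cvg_EFin; [exact: nearW|exact: cvg_geometric_series].
by apply/funext => n; rewrite /= /series/= sumEFin.
Qed.

(** If the mass of every sublevel set $\{\varphi\le y\}$ is at most $y$, the dyadic level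
    set of $\varphi$ of height $2^k$ contributes at most a multiple of
    $2^{k(1-s)}$. *)
Lemma integral_power_of_tail D (rho phi : T -> R) (y0 s : R) : measurable D ->
  0 < y0 -> 1 < s ->
  measurable_fun D rho -> measurable_fun D phi ->
  (forall t, D t -> 0 <= rho t) -> (forall t, D t -> y0 <= phi t) ->
  (forall y, y0 <= y ->
     (\int[mu]_(t in D `&` [set t | (phi t <= y)%R]) (rho t)%:E <= y%:E)%E) ->
  (\int[mu]_(t in D) (rho t * phi t `^ (- s))%:E < +oo)%E.
Proof.
move=> mD y00 s1 mrho mphi rho0 phi0 tail.
have s0 : 0 < s by apply: lt_trans s1.
pose E k := D `&` [set t | phi t <= 2 ^+ k.+1 * y0].
have mE k : measurable (E k).
  rewrite /E (_ : [set t | _] = [set t | ((EFin \o phi) t <= (2 ^+ k.+1 * y0)%:E)%E]).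
    by apply: (emeasurable_fun_infty_c mD); exact/measurable_EFinP.
  by apply/seteqP; split => t /=; rewrite lee_fin.
pose g k t := (((2 ^+ k * y0) `^ (- s))%:E * ((EFin \o rho) \_ (E k)) t)%E.
have ED k : E k `<=` D by move=> t [].
have pk k : 0 < 2 ^+ k * y0 by rewrite mulr_gt0// exprn_gt0.
have r0 k t : (0 <= ((EFin \o rho) \_ (E k)) t)%E.
  by apply: erestrict_ge0 => x [Dx _]; rewrite lee_fin rho0.
pose z : R := 2 `^ (1 - s).
apply: (@integral_geometric_cover _ _ g (2 * y0 `^ (1 - s)) z) => //.
- rewrite powR_ge0/= /z -opprB powRN invf_lt1 ?powR_gt0//.
  have : (1 : R) `^ (s - 1) < 2 `^ (s - 1).
    by apply: gt0_ltr_powR; rewrite ?subr_gt0 ?nnegrE ?ltr1n.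
  by rewrite powR1.
- by move=> t Dt; rewrite lee_fin mulr_ge0 ?powR_ge0// rho0.
- by move=> k t Dt; rewrite mule_ge0// lee_fin powR_ge0.
- move=> k; apply: measurable_funeM; apply/(measurable_restrict _ (mE k) mD).
  rewrite setIidr//; apply/measurable_EFinP.
  exact: measurable_funS mrho.
- move=> t Dt; have [k /andP[k1 k2]] : exists k, 2 ^+ k <= phi t / y0 < 2 ^+ k.+1.
    by apply: dyadic_level; rewrite ler_pdivlMr// mul1r phi0.
  exists k; rewrite /g patchE mem_set; last first.
    by split => //=; rewrite -ler_pdivrMr// ltW.
  rewrite -EFinM lee_fin mulrC ler_wpM2r ?rho0//.
  have phit : 0 < phi t by apply: lt_le_trans (phi0 _ Dt).
  rewrite !powRN lef_pV2 ?posrE ?powR_gt0//.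
  apply: ge0_ler_powR; [exact: ltW|rewrite nnegrE; exact: ltW| |].
    by rewrite nnegrE; exact: ltW.
  by rewrite -ler_pdivlMr.
- move=> k; rewrite ge0_integralZl_EFin ?powR_ge0//; last first.
    apply/(measurable_restrict _ (mE k) mD).
    by rewrite setIidr//; apply/measurable_EFinP; exact: measurable_funS mrho.
  rewrite -integral_mkcondr setIidr//.
  apply: (@le_trans _ _ (((2 ^+ k * y0) `^ (- s))%:E * (2 ^+ k.+1 * y0)%:E)%E).
    apply: lee_wpmul2l; first by rewrite lee_fin powR_ge0.
    by apply: tail; rewrite ler_peMl ?exprn_ege1 ?ler1n// ltW.
  have powB (x : R) : 0 < x -> x `^ (1 - s) = x `^ (- s) * x.
    move=> x0; rewrite addrC powRD ?powRr1 ?ltW//.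
    by apply/implyP => _; rewrite gt_eqF.
  have zk : z ^+ k = (2 ^+ k) `^ (- s) * 2 ^+ k.
    rewrite -powB ?exprn_gt0// /z -powR_mulrn ?powR_ge0//.
    by rewrite -(powR_mulrn k (ler0n R 2)) -!powRrM mulrC.
  rewrite -EFinM lee_fin exprS powRM ?exprn_ge0 ?(ltW y00)// powB// zk.
  rewrite le_eqVlt; apply/orP; left; apply/eqP; ring.
Qed.

End dyadic_covering.

(** * Slowly varying weights *)

Section slowly_varying_weights.
Context {R : realType}.
Notation L := (lebesgueTypeR R).
Notation mu := (@completed_lebesgue_measure R).
Variable v : R -> R.

Lemma measurable_powR_density (q : R) :
  measurable_fun (`]0%R, +oo[%classic : set L) (v : L -> R) ->
  measurable_fun (`]0%R, +oo[%classic : set L) (fun t : L => t^-1 * v t `^ q).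
Proof.
move=> mv; apply: measurable_funM.
  apply: (eq_measurable_fun (fun t : L => (t : R) `^ (-1))).
    by move=> t; rewrite inE/= in_itv/= andbT => t0; rewrite powR_inv1// ltW.
  exact: measurable_powR_lebesgue.
exact: (measurableT_comp (measurable_powR q) mv).
Qed.

Hypothesis svv : slowly_varying v.

Let v0 (t : R) : 0 < t -> 0 < v t.
Proof. by case: svv => + _ _; exact. Qed.

(** $tv(t)$ is equivalent to a non-decreasing function. *)
Lemma slowly_varying_lower (a : R) : 0 < a ->
  exists2 m : R, 0 < m & forall t, a <= t <= a + 1 -> m <= v t.
Proof.
move=> a0; have [_ _ /(_ 1 ltr01)[[g hg [c [C [c0 C0 gv]]]] _]] := svv.
have a10 : 0 < a + 1 by rewrite addr_gt0.
exists (a * v a / (c * C * (a + 1))).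
  by rewrite divr_gt0 ?mulr_gt0// v0.
move=> t /andP[at_ ta]; have t0 : 0 < t by apply: lt_le_trans at_.
have pos (x : R) : 0 < x -> (`]0, +oo[%classic : set R) x by rewrite /= in_itv/= andbT.
rewrite ler_pdivrMr ?mulr_gt0//.
have [+ _] := gv _ (pos _ a0); rewrite (powRr1 (ltW a0)) => ga; apply: (le_trans ga).
apply: (@le_trans _ _ (c * g t)).
  by rewrite ler_pM2l//; apply: hg => //; rewrite in_itv/= andbT.
have [_] := gv _ (pos _ t0); rewrite (powRr1 (ltW t0)) => h.
apply: (@le_trans _ _ (c * (C * (t * v t)))); first by rewrite ler_pM2l.
rewrite [leRHS](_ : _ = c * (C * ((a + 1) * v t))); last by ring.
by rewrite ler_pM2l// ler_pM2l// ler_pM2r// v0.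
Qed.

(** $t^{1/2}v(t)$ is equivalent to a non-decreasing function. *)
Lemma slowly_varying_upper : exists2 M : R, 0 <= M &
  forall t, 0 < t <= 1 -> t `^ 2^-1 * v t <= M.
Proof.
have h20 : (0 : R) < 2^-1 by rewrite invr_gt0 ltr0n.
have [_ _ /(_ _ h20)[[g hg [c [C [c0 C0 gv]]]] _]] := svv.
have pos (x : R) : 0 < x -> (`]0, +oo[%classic : set R) x by rewrite /= in_itv/= andbT.
exists (c * (C * v 1)); first by rewrite !mulr_ge0// ltW// v0.
move=> t /andP[t0 t1]; have [gt_ _] := gv _ (pos _ t0); apply: (le_trans gt_).
rewrite ler_pM2l//; apply: (@le_trans _ _ (g 1)).
  by apply: hg => //; rewrite in_itv/= andbT.
by have [_] := gv _ (pos _ ltr01); rewrite powR1 mul1r.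
Qed.

Lemma measurable_density (q : R) :
  measurable_fun (`]0%R, +oo[%classic : set L) (fun t : L => t^-1 * v t `^ q).
Proof. by apply: measurable_powR_density; case: svv. Qed.

Lemma density_ge0 (q t : R) : 0 < t -> 0 <= t^-1 * v t `^ q.
Proof. by move=> t0; rewrite mulr_ge0 ?powR_ge0// invr_ge0 ltW. Qed.

Lemma integral_density_gt0 (q x : R) : 0 <= q -> 0 < x ->
  (0 < \int[mu]_(t in (`]x, +oo[%classic : set L)) ((t : R)^-1 * v t `^ q)%:E)%E.
Proof.
move=> q0 x0; have [m m0 vm] := slowly_varying_lower x x0.
have sub : (`]x, x + 1]%classic : set L) `<=` `]x, +oo[%classic.
  by move=> t /=; rewrite !in_itv/= andbT => /andP[].
apply: (@lt_le_trans _ _ (\int[mu]_(t in (`]x, (x + 1)%R]%classic : set L))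
    ((t : R)^-1 * v t `^ q)%:E)%E).
  apply: ge0_integral_gt0.
  - exact: itv_lebesgue_measurable.
  - rewrite [X in (_ < X)%E](completed_lebesgue_measure_itv `]x, x + 1]).
    by rewrite /= lte_fin ltrDl ltr01 -EFinB lte_fin addrC addKr.
  exists ((x + 1)^-1 * m `^ q); first by rewrite mulr_gt0 ?powR_gt0// invr_gt0 addr_gt0.
  move=> t /=; rewrite in_itv/= => /andP[xt tx]; have t0 : 0 < t by apply: lt_trans xt.
  rewrite lee_fin; apply: ler_pM.
  - by rewrite invr_ge0 ltW// addr_gt0.
  - exact: powR_ge0.
  - by rewrite lef_pV2// posrE addr_gt0.
  - apply: ge0_ler_powR; rewrite ?nnegrE//; [exact: ltW|exact/ltW/v0|].
    by apply: vm; rewrite ltW.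
apply: ge0_integral_subset => // t /=; rewrite in_itv/= andbT => xt.
by rewrite lee_fin; apply: density_ge0; exact: lt_trans xt.
Qed.

(** The integrand is at most a multiple of $t^{-1/2}$, which is at most $2^{k+1}$ on
    the dyadic piece where $2^k\le t^{-1/2}<2^{k+1}$, a piece of $(0,4^{-k}]$. *)
Lemma integral_linear_weight (q : R) : 1 <= q ->
  (\int[mu]_(t in (`]0%R, 1%R]%classic : set L))
     ((t : R)^-1 * (v t * t) `^ q)%:E < +oo)%E.
Proof.
move=> q1; have q0 : 0 <= q by apply: le_trans q1.
have [M M0 vM] := slowly_varying_upper.
have h0 : (0 : R) <= 2^-1 by rewrite invr_ge0 ler0n.
pose r k : R := ((2 ^+ k) ^+ 2)^-1.
have p2 k : (0 : R) < 2 ^+ k by rewrite exprn_gt0// ltr0n.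
have r0 k : 0 < r k by rewrite invr_gt0 exprn_gt0.
have r1 k : r k <= 1.
  by rewrite invf_le1 ?exprn_gt0// -exprM exprn_ege1// ler1n.
pose g k : L -> \bar R := (cst (M `^ q * 2 ^+ k.+1)%:E) \_ (`]0%R, r k]%classic : set L).
have c0 k : 0 <= M `^ q * 2 ^+ k.+1 by rewrite mulr_ge0 ?powR_ge0// ltW.
apply: (integral_geometric_cover mu _ _ g (M `^ q * 2) 2^-1).
- exact: itv_lebesgue_measurable.
- by rewrite h0/= invf_lt1 ?ltr0n// ltr1n.
- move=> t /=; rewrite in_itv/= => /andP[t0 _].
  by rewrite lee_fin mulr_ge0 ?powR_ge0// invr_ge0 ltW.
- by move=> k t _; apply: erestrict_ge0 => s _; rewrite lee_fin.
- move=> k; apply/measurable_restrict.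
  + exact: itv_lebesgue_measurable.
  + exact: itv_lebesgue_measurable.
  + exact: measurable_cst.
- move=> t /=; rewrite in_itv/= => /andP[t0 t1].
  have s0 : 0 < t `^ 2^-1 by exact: powR_gt0.
  have s1 : t `^ 2^-1 <= 1.
    by rewrite -[leRHS](powRr0 t); apply: ger_powR => //; rewrite t0.
  have ss : t `^ 2^-1 * t `^ 2^-1 = t.
    rewrite -powRD; last by rewrite gt_eqF ?implybT.
    have -> : (2^-1 + 2^-1 : R) = 1 by field.
    by rewrite powRr1// ltW.
  have [k /andP[k1 k2]] : exists k : nat, 2 ^+ k <= (t `^ 2^-1)^-1 < 2 ^+ k.+1.
    by apply: dyadic_level; rewrite invf_ge1.
  exists k; rewrite /g patchE mem_set /=; last first.
    rewrite in_itv/= t0 /= -ss /r expr2 invfM.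
    have h : t `^ 2^-1 <= (2 ^+ k)^-1.
      by rewrite -[leLHS]invrK lef_pV2// posrE// invr_gt0.
    by apply: ler_pM => //; exact: ltW.
  rewrite lee_fin; apply: (@le_trans _ _ (M `^ q * (t `^ 2^-1)^-1)); last first.
    by rewrite ler_wpM2l ?powR_ge0// ltW.
  have -> : (v t * t) `^ q = (t `^ 2^-1 * v t) `^ q * (t `^ 2^-1) `^ q.
    rewrite -powRM ?(ltW s0)//; last by rewrite mulr_ge0// ltW// v0.
    by rewrite mulrAC ss mulrC.
  have e1 : (t `^ 2^-1 * v t) `^ q <= M `^ q.
    apply: ge0_ler_powR; rewrite ?nnegrE//.
      by rewrite mulr_ge0// ltW// v0.
    by apply: vM; rewrite t0.
  have e2 : (t `^ 2^-1) `^ q <= t `^ 2^-1.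
    by apply: ge1r_powR; rewrite ?s0.
  rewrite mulrCA; apply: ler_pM => //; first exact: powR_ge0.
    by rewrite mulr_ge0 ?powR_ge0// invr_ge0 ltW.
  rewrite -{1}ss invfM -mulrA -[leRHS]mulr1 ler_pM2l ?invr_gt0//.
  by rewrite ler_pdivrMl// mulr1.
- move=> k; rewrite -integral_mkcondr integral_cst.
    rewrite setIidr; last first.
      by move=> t /=; rewrite !in_itv/= => /andP[-> h]; exact: le_trans (r1 k).
    rewrite [X in (_ * X <= _)%E](completed_lebesgue_measure_itv `]0, r k]).
    rewrite /= lte_fin r0 -EFinB subr0 -EFinM lee_fin.
    rewrite /r exprS exprVn le_eqVlt; apply/orP; left; apply/eqP; field.
    by rewrite gt_eqF.
  apply: measurableI; exact: itv_lebesgue_measurable.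
Qed.

End slowly_varying_weights.

(** * The tail integral and a weighted Hoelder inequality *)

Section tail_function.
Context {R : realType}.
Notation L := (lebesgueTypeR R).
Notation mu := (@completed_lebesgue_measure R).
Variables (v : R -> R) (q : R).
Hypothesis svv : slowly_varying v.
Hypothesis q1 : 1 <= q.
Hypothesis tail_fin : forall x : R, 0 < x ->
  (\int[mu]_(t in (`]x, +oo[%classic : set L)) ((t : R)^-1 * v t `^ q)%:E < +oo)%E.

Let q0 : 0 <= q. Proof. exact: le_trans q1. Qed.
Let w0 (x t : R) : 0 <= x -> (`]x, +oo[%classic : set L) t ->
  (0 <= (t^-1 * v t `^ q)%:E)%E.
Proof.
move=> x0 /=; rewrite in_itv/= andbT => xt.
by rewrite lee_fin; apply: density_ge0; exact: le_lt_trans xt.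
Qed.

Definition tail_integral (x : R) : R :=
  fine (\int[mu]_(t in (`]x, +oo[%classic : set L)) ((t : R)^-1 * v t `^ q)%:E)%E.
Local Notation G := tail_integral.

Lemma tail_integralE (x : R) : 0 < x -> ((G x)%:E =
  \int[mu]_(t in (`]x, +oo[%classic : set L)) ((t : R)^-1 * v t `^ q)%:E)%E.
Proof.
move=> x0; apply: ge0_integral_fineK; last exact: tail_fin.
by move=> t; apply: w0; exact: ltW.
Qed.

Lemma tail_integral_gt0 (x : R) : 0 < x -> 0 < G x.
Proof.
by move=> x0; rewrite -lte_fin tail_integralE//; exact: integral_density_gt0.
Qed.

Lemma tail_integral_noninc (x y : R) : 0 < x -> x <= y -> G y <= G x.
Proof.
move=> x0 xy; have y0 : 0 < y by apply: lt_le_trans xy.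
rewrite -lee_fin !tail_integralE//; apply: ge0_integral_subset.
  by move=> t /=; rewrite !in_itv/= !andbT; exact: le_lt_trans.
by move=> t; apply: w0; exact: ltW.
Qed.

(** $G$ may be unbounded near zero; its reciprocal, extended by zero, is monotone on
    the whole line. *)
Lemma measurable_tail_integral :
  measurable_fun (`]0%R, +oo[%classic : set L) (fun t : L => G t).
Proof.
pose F (x : R) := if x <= 0 then 0 else (G x)^-1.
have ndF : {homo F : x y / x <= y}.
  move=> x y xy; rewrite /F; case: (leP x 0) => x0.
    by case: (leP y 0) => // y0; rewrite invr_ge0 ltW// tail_integral_gt0.
  have y0 : 0 < y by apply: lt_le_trans xy.
  by rewrite (leNgt y 0) y0 /= lef_pV2 ?posrE ?tail_integral_gt0// tail_integral_noninc.
have mF : measurable_fun (`]0%R, +oo[%classic : set L) (fun t : L => F t `^ (-1)).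
  apply: (borel_lebesgue_measurable_fun _ _ `]0%R, +oo[%classic (fun t : R => F t `^ (-1))).
    exact: measurable_itv.
  apply: (measurableT_comp (measurable_powR (-1))).
  by apply: nondecreasing_measurable => //; exact: measurable_itv.
apply: eq_measurable_fun mF => t; rewrite inE/= in_itv/= andbT => t0.
by rewrite /F leNgt t0/= powR_inv1 ?invrK// invr_ge0 ltW// tail_integral_gt0.
Qed.

(** The sublevel set $\{G\le y\}$ is an interval. Every proper upper part of it lies in
    some $(s,\infty)$ with $G(s)\le y$, and these parts exhaust it up to its left
    endpoint. *)
Lemma tail_sublevel_le (b y : R) : 0 < b -> G b <= y ->
  (\int[mu]_(t in (`]0%R, b]%classic : set L) `&` [set t | (G t <= y)%R])
    ((t : R)^-1 * v t `^ q)%:E <= y%:E)%E.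
Proof.
move=> b0 Gby; set E := _ `&` _.
have E0 t : E t -> 0 < t by move=> [/=]; rewrite in_itv/= => /andP[].
have mD : measurable (`]0%R, b]%classic : set L) by exact: itv_lebesgue_measurable.
have sub0 : (`]0%R, b]%classic : set L) `<=` `]0%R, +oo[%classic.
  by move=> t /=; rewrite !in_itv/= andbT => /andP[].
have mE : measurable E.
  have mG : measurable_fun (`]0%R, b]%classic : set L) (EFin \o (G : L -> R)).
    apply/measurable_EFinP; apply: measurable_funS measurable_tail_integral => //.
    exact: itv_lebesgue_measurable.
  have := emeasurable_fun_infty_c mD mG y%:E.
  by congr (measurable (_ `&` _)); apply/seteqP; split => t /=; rewrite lee_fin.
have Eb : E b by split => //=; rewrite in_itv/= b0 lexx.
have hE : has_inf (E : set R).
  by split; [exists b|exists 0 => t /E0 /ltW].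
pose a := inf (E : set R).
have a0 : 0 <= a by apply: lb_le_inf; [exists b|move=> t /E0 /ltW].
have aE (t : R) : E t -> a <= t by move=> Et; apply: ge_inf => //; exact: hE.2.
pose F n : set L := E `&` `]a + n.+1%:R^-1, +oo[%classic.
have mF n : measurable (F n) by apply: measurableI => //; exact: itv_lebesgue_measurable.
have f0 t : E t -> (0 <= ((t : R)^-1 * v t `^ q)%:E)%E.
  by move=> /E0 t0; rewrite lee_fin; exact: density_ge0.
have leF n : (\int[mu]_(t in F n) ((t : R)^-1 * v t `^ q)%:E <= y%:E)%E.
  have n0 : (0 : R) < n.+1%:R^-1 by rewrite invr_gt0 ltr0n.
  have [s Es sa] := inf_adherent n0 hE.
  have s0 := E0 _ Es; have [_ /= Gs] := Es.
  apply: (@le_trans _ _ (G s)%:E); last by rewrite lee_fin.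
  rewrite tail_integralE//; apply: ge0_integral_subset.
    by move=> t [_ /=]; rewrite !in_itv/= !andbT; exact: lt_trans.
  by move=> t; apply: w0; exact: ltW.
have ndF : {homo F : n m / (n <= m)%N >-> (n <= m)%O}.
  move=> n m nm; apply/subsetPset => t [Et /=]; rewrite !in_itv/= !andbT => h.
  split=> //=; rewrite in_itv/= andbT; apply: le_lt_trans h.
  by rewrite lerD2l lef_pV2 ?posrE ?ltr0n// ler_nat.
have UF : E `<=` [set a] `|` \bigcup_n F n.
  move=> t Et; have := aE _ Et; rewrite le_eqVlt => /predU1P[->|at_]; first by left.
  right; have d0 : 0 < t - a by rewrite subr_gt0.
  have /archi_boundP h : 0 <= (t - a)^-1 by rewrite invr_ge0 ltW.
  exists (Num.bound (t - a)^-1) => //; split => //=; rewrite in_itv/= andbT.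
  rewrite -ltrBrDl -[ltRHS]invrK ltf_pV2 ?posrE ?invr_gt0 ?ltr0n//.
  by apply: (lt_trans h); rewrite ltr_nat.
have mwE : measurable_fun E (fun t : L => ((t : R)^-1 * v t `^ q)%:E).
  apply/measurable_EFinP; apply: measurable_funS (measurable_density _ svv q).
    exact: itv_lebesgue_measurable.
  by move=> t /E0 t0 /=; rewrite in_itv/= andbT.
have UFE : \bigcup_n F n `<=` E by move=> t [n _ []].
have mUF : measurable (\bigcup_n F n) by exact: bigcupT_measurable.
have leU : (\int[mu]_(t in \bigcup_n F n) ((t : R)^-1 * v t `^ q)%:E <= y%:E)%E.
  have := @ge0_nondecreasing_set_cvg_integral _ _ _ F
    (fun t : L => ((t : R)^-1 * v t `^ q)%:E) mu ndF mF.
  move=> /(_ (fun n => measurable_funS mE (@subIsetl _ _ _) mwE)).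
  move=> /(_ (fun n t Ft => f0 t (proj1 Ft))) h.
  by apply: (cvge_to_le h); apply: nearW.
have ma : measurable ([set a] : set L).
  by apply: borel_lebesgue_measurable; exact: measurable_set1.
have mEa : measurable (E `&` [set a]) by exact: measurableI.
have Ea0 : (\int[mu]_(t in E `&` [set a]) ((t : R)^-1 * v t `^ q)%:E = 0)%E.
  rewrite (eq_integral (fun t : L => `|((t : R)^-1 * v t `^ q)%:E|%E)); last first.
    by move=> t; rewrite inE => -[Et _]; rewrite gee0_abs// f0.
  apply: integral_abs_eq0; first exact: mEa.
    exact: measurable_funS mwE.
  apply/eqP; rewrite eq_le measure_ge0 andbT.
  apply: (@le_trans _ _ (mu ([set a] : set L))).
    by apply: le_measure; rewrite ?inE.
  have -> : ([set a] : set L) = [set` `[a, a]] by rewrite set_itv1.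
  by rewrite [X in (X <= _)%E](completed_lebesgue_measure_itv `[a, a]) /= ltxx.
apply: (@le_trans _ _ (\int[mu]_(t in (E `&` [set a]) `|` \bigcup_n F n)
    ((t : R)^-1 * v t `^ q)%:E)%E).
  apply: ge0_integral_subset.
    by move=> t Et; case: (UF _ Et) => h; [left|right].
  by move=> t [[Et _]|/UFE Et]; exact: f0.
apply: (le_trans (ge0_integral_setU_le mu (E `&` [set a]) (\bigcup_n F n) _ mEa mUF _)).
  by move=> t [[Et _]|/UFE Et]; exact: f0.
by rewrite Ea0 add0e.
Qed.

Lemma integral_density_tail_lt_pinfty (b s : R) : 0 < b -> 1 < s ->
  (\int[mu]_(t in (`]0%R, b]%classic : set L))
     ((t : R)^-1 * v t `^ q * G t `^ (- s))%:E < +oo)%E.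
Proof.
move=> b0 s1; have sub0 : (`]0%R, b]%classic : set L) `<=` `]0%R, +oo[%classic.
  by move=> t /=; rewrite !in_itv/= andbT => /andP[].
apply: (integral_power_of_tail mu _ (fun t : L => t^-1 * v t `^ q) (fun t : L => G t)
  (G b) s).
- exact: itv_lebesgue_measurable.
- exact: tail_integral_gt0.
- exact: s1.
- apply: measurable_funS (measurable_density _ svv q) => //.
  exact: itv_lebesgue_measurable.
- apply: measurable_funS measurable_tail_integral => //.
  exact: itv_lebesgue_measurable.
- by move=> t /sub0 /=; rewrite in_itv/= andbT => t0; exact: density_ge0.
- move=> t /=; rewrite in_itv/= => /andP[t0 tb]; exact: tail_integral_noninc.
- move=> y; exact: tail_sublevel_le.
Qed.

End tail_function.

Section weighted_hoelder.
Context {R : realType}.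
Notation L := (lebesgueTypeR R).
Notation mu := (@completed_lebesgue_measure R).
Variables (v A : R -> R) (q : R).
Hypothesis svv : slowly_varying v.
Hypothesis q1 : 1 <= q.
Hypothesis tail_fin : forall x : R, 0 < x ->
  (\int[mu]_(t in (`]x, +oo[%classic : set L)) ((t : R)^-1 * v t `^ q)%:E < +oo)%E.
Local Notation G := (tail_integral v q).
Hypothesis hA : forall x : R, 0 < x ->
  A x = v x `^ (- (q * (1 - q^-1))) * G x.

Let q0 : 0 < q. Proof. exact: lt_le_trans q1. Qed.
Let v0 (t : R) : 0 < t -> 0 < v t.
Proof. by case: svv => + _ _; exact. Qed.
Let G0 (t : R) : 0 < t -> 0 < G t.
Proof. exact: tail_integral_gt0. Qed.

Lemma weight_gt0 (t : R) : 0 < t -> 0 < A t.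
Proof. by move=> t0; rewrite hA// mulr_gt0 ?powR_gt0 ?v0 ?G0. Qed.

Lemma measurable_weight :
  measurable_fun (`]0%R, +oo[%classic : set L) (fun t : L => A t).
Proof.
have [_ mv _] := svv.
apply: (eq_measurable_fun (fun t : L => v t `^ (- (q * (1 - q^-1))) * G t)).
  by move=> t; rewrite inE/= in_itv/= andbT => t0; rewrite hA.
apply: measurable_funM; first exact: (measurableT_comp (measurable_powR _) mv).
exact: measurable_tail_integral.
Qed.

(** By Hoelder's inequality it suffices that $t^{-1/q'}A(t)^{-1}$ lies in $L_{q'}$ near
    zero. For $q=1$ this means that $A$ is bounded below; for $q>1$ the $q'$-th
    power is $t^{-1}v^q(t)$ times the power $-q'$ of the tail integral. *)
Lemma weighted_hoelder (b : R) : 0 < b -> exists2 C : R, 0 <= C &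
  forall n : L -> R, (forall t, 0 <= n t) ->
  measurable_fun (`]0%R, b]%classic : set L) n ->
  (\int[mu]_(t in (`]0%R, b]%classic : set L)) ((t : R)^-1 * n t)%:E <=
   C%:E * Lq_norm q (`]0%R, b]%classic : set L)
      (fun t : L => ((t : R) `^ (- q^-1) * A t * n t)%:E))%E.
Proof.
move=> b0; set D := (`]0%R, b]%classic : set L).
have mD : measurable D by exact: itv_lebesgue_measurable.
have D0 t : D t -> 0 < t by rewrite /D/= in_itv/= => /andP[].
have Db t : D t -> t <= b by rewrite /D/= in_itv/= => /andP[].
have mA : measurable_fun D (fun t : L => A t).
  apply: measurable_funS measurable_weight; first exact: itv_lebesgue_measurable.
  by move=> t /D0 /=; rewrite in_itv/= andbT.
have [q1E|qneq1] := eqVneq q 1.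
  have Gb : 0 <= (G b)^-1 by rewrite invr_ge0; apply/ltW/G0.
  have AE t : 0 < t -> A t = G t.
    by move=> t0; rewrite hA// q1E invr1 subrr mulr0 oppr0 powRr0 mul1r.
  have tE (t : R) : 0 < t -> t `^ (- q^-1) = t^-1.
    by move=> t0; rewrite q1E invr1 powR_inv1// ltW.
  exists (G b)^-1 => // n n0 mn.
  have F0 t : D t -> (0 <= ((t : R) `^ (- q^-1) * A t * n t)%:E)%E.
    move=> /D0 t0; rewrite lee_fin; apply: mulr_ge0 => //.
    by apply: mulr_ge0; [exact: powR_ge0|exact/ltW/weight_gt0].
  have -> : Lq_norm q D (fun t => ((t : R) `^ (- q^-1) * A t * n t)%:E) =
      (\int[mu]_(t in D) ((t : R) `^ (- q^-1) * A t * n t)%:E)%E.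
    rewrite Lq_normE// {2 3}q1E invr1 poweRe1.
      by apply: eq_integral => t; rewrite inE => Dt; rewrite poweRe1//; exact: F0.
    by apply: integral_ge0 => t _; exact: poweR_ge0.
  rewrite -ge0_integralZl_EFin; first last.
  - exact: Gb.
  - apply/measurable_EFinP; apply: measurable_funM; last exact: mn.
    by apply: measurable_funM; [exact: measurable_powR_lebesgue|exact: mA].
  - exact: F0.
  - exact: mD.
  apply: le_ge0_integral => t Dt; have t0 := D0 _ Dt.
    by rewrite lee_fin mulr_ge0// invr_ge0 ltW.
  rewrite -EFinM lee_fin tE// AE//.
  have -> : (G b)^-1 * (t^-1 * G t * n t) = (t^-1 * n t) * ((G b)^-1 * G t) by ring.
  apply: ler_peMr; first by rewrite mulr_ge0// invr_ge0 ltW.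
  rewrite ler_pdivlMl ?mulr1; last exact: G0.
  by apply: tail_integral_noninc => //; exact: Db.
have q1' : 1 < q by rewrite lt_neqAle eq_sym qneq1.
pose c := 1 - q^-1.
have c0 : 0 < c by rewrite subr_gt0 invf_lt1.
have c1 : c < 1 by rewrite ltrBlDr ltrDl invr_gt0.
have qc0 : 0 < c^-1 by rewrite invr_gt0.
pose g0 (t : L) := (t : R) `^ (- c) * (A t)^-1.
pose g := g0 \_ D.
have mA' : measurable_fun D (fun t : L => (A t)^-1).
  apply: (eq_measurable_fun (fun t : L => A t `^ (-1))).
    by move=> t; rewrite inE => /D0 t0; rewrite powR_inv1// ltW// weight_gt0.
  exact: (measurableT_comp (measurable_powR (-1)) mA).
have mg : measurable_fun setT g.
  apply/(measurable_restrictT _ mD).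
  by apply: measurable_funM; [exact: measurable_powR_lebesgue|exact: mA'].
have gE t : D t -> g0 t `^ c^-1 = t^-1 * v t `^ q * G t `^ (- c^-1).
  move=> Dt; have t0 := D0 _ Dt.
  have At := weight_gt0 _ t0.
  rewrite /g0 powRM ?powR_ge0//; last by rewrite invr_ge0 ltW.
  rewrite -powRrM mulNr divff ?gt_eqF// powR_inv1 ?ltW// -mulrA; congr (_ * _).
  have Gt := ltW (G0 _ t0).
  rewrite hA// -/c powRN invfM invrK powRM ?powR_ge0 ?invr_ge0//.
  by rewrite -powRrM mulfK ?gt_eqF// -(powR_inv1 Gt) -powRrM mulN1r.
have g_ge0 t : 0 <= g t.
  rewrite /g patchE; case: ifPn => // /set_mem /D0 t0.
  by rewrite mulr_ge0 ?powR_ge0// invr_ge0 ltW// weight_gt0.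
have Ng : (\int[mu]_t (`|(g t)%:E| `^ c^-1) < +oo)%E.
  have := integral_density_tail_lt_pinfty v q svv q1 tail_fin b c^-1 b0.
  rewrite invf_gt1// => /(_ c1); rewrite integral_mkcond.
  congr (_ < _)%E; apply: eq_integral => t _; rewrite gee0_abs ?lee_fin//.
  rewrite patchE /g patchE; case: ifPn => [/set_mem Dt|_].
    by rewrite poweR_EFin gE.
  by rewrite poweR0r// gt_eqF.
have NgE : (Lnorm mu (c^-1)%:E (EFin \o g) < +oo)%E.
  rewrite unlock; apply: poweR_lty; exact: Ng.
exists (fine (Lnorm mu (c^-1)%:E (EFin \o g))).
  by rewrite fine_ge0// Lnorm_ge0.
move=> n n0 mn; rewrite fineK; last first.
  by rewrite ge0_fin_numE// Lnorm_ge0.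
pose f := (fun t : L => (t : R) `^ (- q^-1) * A t * n t) \_ D.
have mf : measurable_fun setT f.
  apply/(measurable_restrictT _ mD); apply: measurable_funM; last exact: mn.
  by apply: measurable_funM; [exact: measurable_powR_lebesgue|exact: mA].
have pq : q^-1 + (c^-1)^-1 = 1 by rewrite invrK /c addrC subrK.
have := hoelder mu mf mg q0 qc0 pq.
have -> : Lnorm mu q%:E (EFin \o f) = Lq_norm q D
    (fun t : L => ((t : R) `^ (- q^-1) * A t * n t)%:E).
  rewrite /Lq_norm; congr (Lnorm mu _ _); apply/funext => t.
  by rewrite /f/= !patchE; case: ifP.
rewrite muleC Lnorm1; apply: le_trans.
rewrite [leLHS]integral_mkcond le_eqVlt; apply/orP; left; apply/eqP.
apply: eq_integral => t _; rewrite /= /f /g !patchE.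
case: ifPn => [/set_mem Dt|_]; last by rewrite mul0r normr0.
have t0 := D0 _ Dt; have At := weight_gt0 _ t0.
rewrite ger0_norm; last first.
  by rewrite !mulr_ge0 ?powR_ge0 ?invr_ge0// ltW.
congr (_%:E); rewrite /g0.
have -> : t `^ (- q^-1) * A t * n t * (t `^ (- c) * (A t)^-1) =
    (t `^ (- q^-1) * t `^ (- c)) * n t.
  by field; rewrite gt_eqF.
rewrite -powRD; last by apply/implyP => _; rewrite gt_eqF.
rewrite -opprD (_ : q^-1 + c = 1); last by rewrite /c addrC subrK.
by rewrite powR_inv1// ltW.
Qed.

End weighted_hoelder.

(** * $J$-spaces over $(1,\infty)$ *)

Section J_spaces.
Context {R : realType} {Z : lmodType R}.
Notation L := (lebesgueTypeR R).
Notation mu := (@completed_lebesgue_measure R).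
Implicit Types (Y : nspace Z) (I D : set L) (u w : L -> Z).

Lemma eq_strongly_measurable Y I u w : (forall t, I t -> u t = w t) ->
  strongly_measurable Y I u -> strongly_measurable Y I w.
Proof.
move=> uw /strongly_measurableP[Yu [phi sphi phiu]]; apply/strongly_measurableP.
split=> [t It|]; first by rewrite -uw//; exact: Yu.
by exists phi => //; apply: filterS phiu => t h It; rewrite -uw//; exact: h.
Qed.

Lemma eq_has_bochner_integral Y I u w f : (forall t, I t -> u t = w t) ->
  has_bochner_integral Y I u f -> has_bochner_integral Y I w f.
Proof.
move=> uw [smu Yf [s [cs cf]]]; split => //.
  exact: eq_strongly_measurable smu.
exists s; split => //; rewrite (_ : (fun n => _) =
  fun n => \int[mu]_(t in I) nrm Y (u t - step_eval (s n) t))%E//.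
by apply/funext => n; apply: eq_integral => t; rewrite inE => It; rewrite uw.
Qed.

Lemma Jfun_ge0 (Y0 Y1 : nspace Z) f (t : R) : seminormed Y0 ->
  (0 <= Jfun Y0 Y1 f t)%E.
Proof. by move=> s0; rewrite /Jfun le_max nrm_ge0. Qed.

Lemma Jfun0 (Y0 Y1 : nspace Z) (t : R) : seminormed Y0 -> seminormed Y1 ->
  Jfun Y0 Y1 0 t = 0%E.
Proof. by move=> s0 s1; rewrite /Jfun !nrm0// mule0 maxxx. Qed.

(** A representation over a smaller set is extended by zero. *)
Lemma Jspace_extend0 (q : R) (A : R -> R) (Y0 Y1 : nspace Z) I I' f :
  seminormed Y0 -> seminormed Y1 -> I `<=` I' ->
  (nrm (Jspace q A I' Y0 Y1) f <= nrm (Jspace q A I Y0 Y1) f)%E.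
Proof.
move=> s0 s1 II'; apply: le_ereal_inf_tmp => _ [u [smu bu] <-].
apply: ereal_inf_lbound; exists (fun t => (\1_I t : R) *: u t).
  split.
    apply: (strongly_measurable_extend0 _ I); [exact: cap_seminormed|exact: II'| |].
      by move=> t nIt; rewrite indicE memNset// scale0r.
    apply: eq_strongly_measurable smu => t It.
    by rewrite indicE mem_set// scale1r.
  apply: (has_bochner_integral_extend0 _ I); [exact: sum_seminormed|exact: II'| |].
    by move=> t nIt; rewrite indicE memNset// scale0r scaler0.
  apply: eq_has_bochner_integral bu => t It.
  by rewrite indicE mem_set// scale1r.
rewrite /Lq_norm; congr (Lnorm mu _ _); apply/funext => t; rewrite !patchE.
have [It|nIt] := pselect (I t).
  by rewrite !mem_set//; [rewrite indicE mem_set// scale1r|exact: II'].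
rewrite indicE (memNset nIt) scale0r Jfun0// mule0.
by case: ifP.
Qed.

End J_spaces.

Section J_spaces_tail.
Context {R : realType} {Z : lmodType R} {X : completeNormedModType R}.
Notation L := (lebesgueTypeR R).
Notation mu := (@completed_lebesgue_measure R).
Variables (i : {linear X -> Z}) (X1 : nspace Z) (v A : R -> R) (q : R).
Hypotheses (inj_i : injective i) (s1 : seminormed X1).
Hypothesis svv : slowly_varying v.
Hypothesis q1 : 1 <= q.
Hypothesis tail_fin : forall x : R, 0 < x ->
  (\int[mu]_(t in (`]x, +oo[%classic : set L)) ((t : R)^-1 * v t `^ q)%:E < +oo)%E.
Local Notation G := (tail_integral v q).
Hypothesis hA : forall x : R, 0 < x ->
  A x = v x `^ (- (q * (1 - q^-1))) * G x.
Local Notation X0 := (embedded_space i).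
Local Notation S := (sum_space X0 X1).
Local Notation T := (sum_space X0 S).

Let q0 : 0 < q. Proof. exact: lt_le_trans q1. Qed.
Let s0 : seminormed X0. Proof. exact: embedded_seminormed. Qed.
Let sS : seminormed S. Proof. exact: sum_seminormed. Qed.
Let sT : seminormed T. Proof. exact: sum_seminormed. Qed.
Let sC : seminormed (cap_space X0 S). Proof. exact: cap_seminormed. Qed.

Let I0 : set L := `]0, +oo[.
Let I1 : set L := `]1, +oo[.
Let D : set L := `]0, 2].
Let E : set L := `]1, 2].
Let g (u : L -> Z) (t : L) : \bar R :=
  ((t `^ (- q^-1) * A t)%:E * Jfun X0 S (u t) t)%E.

Let A0 (t : R) : 0 < t -> 0 < A t.
Proof. by move=> t0; apply: (weight_gt0 v A q). Qed.

Let g_ge0 u t : I0 t -> (0 <= g u t)%E.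
Proof.
rewrite /I0 /= in_itv/= andbT => t0; apply: mule_ge0.
  by rewrite lee_fin; apply: mulr_ge0; [exact: powR_ge0|exact/ltW/A0].
exact: Jfun_ge0.
Qed.

Lemma weight_bounded12 : exists2 M : R, 0 <= M &
  forall t, 1 <= t <= 2 -> A t <= M.
Proof.
have [m m0 vm] := slowly_varying_lower v svv 1 ltr01.
have G1 : 0 < G 1 by exact: tail_integral_gt0.
exists (m `^ (- (q * (1 - q^-1))) * G 1); first by rewrite mulr_ge0 ?powR_ge0// ltW.
move=> t /andP[t1 t2]; have t0 : 0 < t by apply: lt_le_trans t1.
have mv : m <= v t by apply: vm; rewrite t1 -[1 + 1]/(2 : R).
have qc : 0 <= q * (1 - q^-1).
  by apply: mulr_ge0; [exact: ltW|rewrite subr_ge0 invf_le1].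
rewrite hA//; apply: ler_pM; [exact: powR_ge0|exact/ltW/tail_integral_gt0| |].
  rewrite !powRN lef_pV2 ?posrE ?powR_gt0//; last by apply: lt_le_trans mv.
  by apply: ge0_ler_powR => //; rewrite nnegrE ltW//; exact: lt_le_trans mv.
exact: tail_integral_noninc.
Qed.

Let mI0 : measurable I0. Proof. exact: itv_lebesgue_measurable. Qed.
Let mI1 : measurable I1. Proof. exact: itv_lebesgue_measurable. Qed.
Let mD : measurable D. Proof. exact: itv_lebesgue_measurable. Qed.
Let mE : measurable E. Proof. exact: itv_lebesgue_measurable. Qed.

Let DI0 : D `<=` I0.
Proof. by move=> t; rewrite /D /I0/= !in_itv/= andbT => /andP[]. Qed.
Let ED : E `<=` D.
Proof.
move=> t; rewrite /D /E/= !in_itv/= => /andP[t1 ->]; rewrite andbT.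
exact: lt_trans t1.
Qed.
Let I1I0 : I1 `<=` I0.
Proof. by move=> t; rewrite /I1 /I0/= !in_itv/= !andbT; exact: lt_trans. Qed.
Let I1E : (I0 `\` D) `|` E = I1.
Proof.
apply/seteqP; split => t.
  case=> [[]|]; rewrite /I0 /I1 /D /E/= !in_itv/= ?andbT.
    move=> t0; rewrite t0/= => /negP; rewrite -ltNge; apply: lt_trans.
    by rewrite ltr1n.
  by case/andP.
rewrite /I0 /I1 /D /E/= !in_itv/= !andbT => t1; have t0 : 0 < t by apply: lt_trans t1.
by case: (leP t 2) => t2; [right; rewrite t1|left; rewrite t0; split].
Qed.
Let muE : mu E = 1%E.
Proof.
rewrite /E [LHS](completed_lebesgue_measure_itv `]1, 2])/= lte_fin ltr1n -EFinB.
by rewrite (_ : 2 - 1 = 1 :> R) //; ring.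
Qed.

Let sub0S : subspace_of X0 S. Proof. exact: sub_sum_l. Qed.
Let sub0T : subspace_of X0 T. Proof. exact: sub_sum_l. Qed.

(** The part of the representing function over $(0,2]$ is Bochner integrable in the
    complete space $X_0$: there the $J$-functional dominates the norm of $X_0$. *)
Lemma head_integral : exists2 C : R, 0 <= C &
  forall u, strongly_measurable (cap_space X0 S) I0 u -> (Lq_norm q I0 (g u) < +oo)%E ->
  exists x, [/\ carrier X0 x, (nrm X0 x <= C%:E * Lq_norm q I0 (g u))%E &
  exists (phi : nat -> L -> Z) (z : nat -> Z),
    [/\ forall n, is_step X0 D (phi n) (z n),
    (\int[mu]_(t in D) nrm X0 ((t : R)^-1 *: u t - phi n t))%E @[n --> \oo] --> 0%E &
    nrm X0 (x - z n) @[n --> \oo] --> 0%E]].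
Proof.
have two0 : (0 : R) < 2 by rewrite ltr0n.
have [C C0 hC] := weighted_hoelder v A q svv q1 tail_fin hA 2 two0.
exists C => // u smu fu.
have smuD : strongly_measurable X0 D u.
  apply: (strongly_measurable_subset _ I0) => //.
  by apply: strongly_measurable_weaken smu => //; exact: sub_cap_l.
have [Xu _] := smuD.
have t0 t : D t -> 0 < t by rewrite /D/= in_itv/= => /andP[].
pose n t := fine (nrm X0 (u t)).
have n0 t : 0 <= n t by rewrite fine_ge0// nrm_ge0.
have nE t : D t -> nrm X0 (u t) = (n t)%:E.
  by move=> Dt; rewrite fineK// nrm_fin//; exact: Xu.
have mn : measurable_fun D n.
  by apply: (measurableT_comp (fine_measurable _)); [|exact: measurable_nrm].
have smw : strongly_measurable X0 D (fun t => (t : R)^-1 *: u t).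
  apply: (eq_strongly_measurable _ _ (fun t => (t : R) `^ (-1) *: u t)).
    by move=> t Dt; rewrite powR_inv1// ltW// t0.
  apply: strongly_measurableZ; [exact: s0|exact: mD| |exact: smuD].
  exact: measurable_powR_lebesgue.
have wE : (\int[mu]_(t in D) nrm X0 ((t : R)^-1 *: u t) =
    \int[mu]_(t in D) ((t : R)^-1 * n t)%:E)%E.
  apply: eq_integral => t; rewrite inE => Dt; rewrite nrmZ//; last exact: Xu.
  by rewrite nE// -EFinM ger0_norm// invr_ge0 ltW// t0.
have leD : (Lq_norm q D (fun t : L => ((t : R) `^ (- q^-1) * A t * n t)%:E)
    <= Lq_norm q I0 (g u))%E.
  have one : (1 : R) = 1 `^ q^-1 by rewrite powR1.
  rewrite -[leRHS]mul1e [X in (_ <= X%:E * _)%E]one.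
  apply: Lq_norm_le_scale; [exact: q0|exact: ler01| | |].
  - exact: g_ge0.
  - move=> t /t0 tp; rewrite lee_fin; apply: mulr_ge0 => //.
    by apply: mulr_ge0; [exact: powR_ge0|exact/ltW/A0].
  - rewrite mul1e; apply: (@le_trans _ _ (\int[mu]_(t in D) (g u t `^ q))%E).
      apply: le_ge0_integral => t Dt; first exact: poweR_ge0.
      have tp := t0 _ Dt; have wt : 0 <= (t : R) `^ (- q^-1) * A t.
        by apply: mulr_ge0; [exact: powR_ge0|exact/ltW/A0].
      apply: le_poweR; [exact: ltW|by rewrite lee_fin mulr_ge0|].
      rewrite /g EFinM; apply: lee_wpmul2l; first by rewrite lee_fin.
      by rewrite -nE// /Jfun le_max lexx.
    by apply: ge0_integral_subset => // t _; exact: poweR_ge0.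
have le_w : (\int[mu]_(t in D) nrm X0 ((t : R)^-1 *: u t) <=
    C%:E * Lq_norm q I0 (g u))%E.
  rewrite wE; apply: (le_trans (hC n n0 mn)).
  by apply: lee_wpmul2l; [rewrite lee_fin|exact: leD].
have fw : (\int[mu]_(t in D) nrm X0 ((t : R)^-1 *: u t) < +oo)%E.
  apply: (le_lt_trans le_w); apply: lte_mul_pinfty; [|by []|exact: fu].
  by rewrite lee_fin.
have [x [Xx nx hx]] := bochner_complete X i D _ inj_i mD smw fw.
by exists x; split => //; exact: (le_trans nx).
Qed.

(** Moving the integral $x$ over $(0,2]$ into $(1,2]$ costs at most a multiple of the
    norm of $x$ in $X_0$, as the weight is bounded on $(1,2]$. *)
Lemma tail_representation : exists2 C : R, 0 < C &
  forall f u, Jrepresentation I0 X0 S f u ->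
  (nrm (Jspace q A I1 X0 S) f <= C%:E * Lq_norm q I0 (g u))%E.
Proof.
have [C C0 head] := head_integral.
have [M M0 AM] := weight_bounded12.
pose K := (M * 4 * C) `^ q + 1.
have K0 : 0 < K by rewrite ltr_wpDl// powR_ge0.
exists (K `^ q^-1); first exact: powR_gt0.
move=> f u [smu bu].
have [->|fu] := eqVneq (Lq_norm q I0 (g u)) +oo%E.
  by rewrite gt0_muley ?leey// lte_fin powR_gt0.
have {}fu : (Lq_norm q I0 (g u) < +oo)%E by rewrite ltey.
have [x [Xx nx [psi [y [hy cpsi cy]]]]] := head u smu fu.
move/has_bochner_integralP : bu => [smw Tf [phi [z [hz cphi cz]]]].
(* The factor t in the second summand makes u' t / t equal to x on E, which has
   measure one. *)
pose u' (t : L) := (\1_(~` D) t : R) *: u t + (t : R) *: ((\1_E t : R) *: x).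
have [XS nXS] := sub0S; have [XT nXT] := sub0T.
have stepT n : is_step T D (psi n) (y n) by apply: is_step_weaken (hy n).
have Xpsi n t : carrier X0 (psi n t) by have [] := is_step_carrier _ _ _ _ s0 (hy n).
have Xy n : carrier X0 (y n) by have [] := is_step_carrier _ _ _ _ s0 (hy n).
have [Cu _] := smu.
have cpsiT : (\int[mu]_(t in D) nrm T ((t : R)^-1 *: u t - psi n t))%E
    @[n --> \oo] --> 0%E.
  apply: (cvge0_le _ _ _ cpsi) => n; apply/andP; split.
    by apply: integral_ge0 => t _; exact: (nrm_ge0 _ sT).
  apply: le_ge0_integral => t Dt; first exact: (nrm_ge0 _ sT).
  apply: nXT; apply: carrierB => //; apply: carrierZ => //.
  by have [] := Cu _ (DI0 _ Dt).
have cyT : nrm T (x - y n) @[n --> \oo] --> 0%E.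
  apply: (cvge0_le _ _ _ cy) => n; rewrite (nrm_ge0 _ sT) andTb; apply: nXT.
  exact: carrierB.
have [phi' [z' [hz' cphi' cz']]] := bochner_relocate T I0 D E _ f x phi psi z y
  sT mI0 mD mE DI0 ED muE smw (XT _ Xx) Tf hz cphi cz stepT cpsiT cyT.
rewrite I1E in hz' cphi'.
have smu' : strongly_measurable (cap_space X0 S) I1 u'.
  apply: strongly_measurableD; first exact: sC.
    apply: strongly_measurableZ; [exact: sC|exact: mI1| |].
      by apply: measurable_indic; exact: measurableC.
    exact: strongly_measurable_subset smu.
  apply: strongly_measurableZ; [exact: sC|exact: mI1| |].
    apply: (borel_lebesgue_measurable_fun _ _ `]1, +oo[%classic (fun t : R => t)).
      exact: measurable_itv.
    exact: measurable_id.
  have sE := is_step_indic (cap_space X0 S) I1 E x mE.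
  apply: (strongly_measurable_step _ _ _ _ sC (sE _ _ _)).
  - by move=> t; rewrite /E /I1/= !in_itv/= andbT => /andP[].
  - by rewrite [X in (X < _)%E]muE ltry.
  - by split => //; exact: XS.
have w'E t : I1 t -> (\1_(~` D) t : R) *: ((t : R)^-1 *: u t) + (\1_E t : R) *: x =
    (t : R)^-1 *: u' t.
  rewrite /I1/= in_itv/= andbT => t1; have tn0 : t != 0 :> R.
    by rewrite gt_eqF//; exact: lt_trans t1.
  by rewrite /u' scalerDr !scalerA mulrC mulrA mulVf// mul1r.
have rep : Jrepresentation I1 X0 S f u'.
  split => //; apply/has_bochner_integralP; split => //.
    apply: (eq_strongly_measurable _ _ (fun t => (t : R) `^ (-1) *: u' t)).
      move=> t; rewrite /I1/= in_itv/= andbT => t1; rewrite powR_inv1//.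
      by rewrite ltW//; exact: lt_trans t1.
    apply: strongly_measurableZ; [exact: sT|exact: mI1| |].
      exact: measurable_powR_lebesgue.
    apply: strongly_measurable_weaken smu'; [exact: sC|exact: sT|].
    by apply: subspace_of_trans sub0T; exact: sub_cap_l.
  exists phi', z'; split; [exact: hz'| |exact: cz']; rewrite (_ : (fun n => _) = fun n => \int[mu]_(t in I1)
    nrm T ((\1_(~` D) t : R) *: ((t : R)^-1 *: u t) + (\1_E t : R) *: x - phi' n t))%E//.
  by apply/funext => n; apply: eq_integral => t; rewrite inE => It; rewrite w'E.
apply: (@le_trans _ _ (Lq_norm q I1 (g u'))).
  by apply: ereal_inf_lbound; exists u'.
apply: Lq_norm_le_scale; [exact: q0|exact: ltW|by move=> t; exact: g_ge0| |].
  by move=> t /I1I0; exact: g_ge0.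
pose I2 : set L := `]2, +oo[%classic.
have I1cut : I1 = E `|` I2.
  apply/seteqP; split => t; rewrite /I1 /E /I2/= !in_itv/= !andbT.
    by move=> t1; case: (leP t 2) => t2; [left; rewrite t1|right].
  by move=> [/andP[]//|]; apply: lt_trans; rewrite ltr1n.
have I2I0 : I2 `<=` I0.
  by move=> t It; apply: I1I0; rewrite I1cut; right.
have [r nxE] : exists r, nrm X0 x = r%:E.
  by exists (fine (nrm X0 x)); rewrite fineK// nrm_fin.
have r0 : 0 <= r by rewrite -lee_fin -nxE nrm_ge0.
have gE t : E t -> (g u' t <= (M * 4 * r)%:E)%E.
  move=> Et; have := Et; rewrite /E/= in_itv/= => /andP[t1 t2].
  have t0 : 0 < t by apply: lt_trans t1.
  rewrite /g; have -> : u' t = t *: x.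
    rewrite /u' !indicE memNset; last by apply; exact: ED.
    by rewrite mem_set// scale0r add0r scale1r.
  have Sx := XS _ Xx.
  apply: (@le_trans _ _ (M%:E * (4 * r)%:E)%E); last first.
    by rewrite -!EFinM mulrA.
  apply: lee_pmul.
  - by rewrite lee_fin; apply: mulr_ge0; [exact: powR_ge0|exact/ltW/A0].
  - exact: Jfun_ge0.
  - rewrite lee_fin; have At : A t <= M by apply: AM; rewrite (ltW t1).
    have tq : t `^ (- q^-1) <= 1.
      rewrite powRN invf_le1 ?powR_gt0// -[leLHS](powRr0 t) ler_powR ?(ltW t1)//.
      by rewrite invr_ge0 ltW.
    rewrite -[leRHS]mul1r; apply: ler_pM => //; first exact: powR_ge0.
    exact/ltW/A0.
  rewrite /Jfun ge_max !nrmZ// (ger0_norm (ltW t0)); apply/andP; split.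
    rewrite nxE -EFinM lee_fin ler_wpM2r//; apply: (le_trans t2).
    by rewrite ler_nat.
  rewrite muleA -EFinM; apply: (@le_trans _ _ (4%:E * nrm X0 x)%E).
    apply: lee_pmul; [by rewrite lee_fin mulr_ge0// ltW|exact: nrm_ge0| |exact: nXS].
    rewrite lee_fin (_ : 4 = 2 * 2 :> R); last by rewrite -natrM.
    by apply: ler_pM => //; exact: ltW.
  by rewrite nxE.
have NE : (\int[mu]_(t in I0) (g u t `^ q))%E = (Lq_norm q I0 (g u) `^ q)%E.
  rewrite Lq_normE//; last exact: g_ge0.
  rewrite -poweRrM mulVf ?gt_eqF// poweRe1//.
  by apply: integral_ge0 => t _; exact: poweR_ge0.
have partE : (\int[mu]_(t in E) (g u' t `^ q) <=
    ((M * 4 * C) `^ q)%:E * \int[mu]_(t in I0) (g u t `^ q))%E.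
  apply: (@le_trans _ _ (\int[mu]_(t in E) (cst ((M * 4 * r)%:E `^ q) t))%E).
    apply: le_ge0_integral => t Et; first exact: poweR_ge0.
    by apply: le_poweR; [exact: ltW|exact/g_ge0/DI0/ED|exact: gE].
  rewrite integral_cst// [X in (_ * X <= _)%E]muE mule1 NE -poweR_EFin -poweRM.
  - apply: le_poweR; [exact: ltW|by rewrite lee_fin !mulr_ge0|].
    rewrite [in leRHS]EFinM -muleA EFinM; apply: lee_wpmul2l.
      by rewrite lee_fin mulr_ge0.
    by rewrite -nxE.
  - by rewrite lee_fin !mulr_ge0.
  - exact: Lq_norm_ge0.
have partI2 : (\int[mu]_(t in I2) (g u' t `^ q) <= \int[mu]_(t in I0) (g u t `^ q))%E.
  rewrite [leLHS](_ : _ = \int[mu]_(t in I2) (g u t `^ q))%E.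
    by apply: ge0_integral_subset => // t _; exact: poweR_ge0.
  apply: eq_integral => t; rewrite inE /I2/= in_itv/= andbT => t2.
  rewrite /g /u' !indicE mem_set; last first.
    by rewrite /D/= in_itv/= => /andP[_]; rewrite leNgt t2.
  rewrite memNset; last by rewrite /E/= in_itv/= => /andP[_]; rewrite leNgt t2.
  by rewrite scale1r scale0r scaler0 addr0.
rewrite I1cut; apply: (le_trans (ge0_integral_setU_le mu E I2 _ mE _ _)).
- exact: itv_lebesgue_measurable.
- by move=> t _; exact: poweR_ge0.
rewrite /K EFinD ge0_muleDl; [|by rewrite lee_fin powR_ge0|exact: lee01].
by rewrite mul1e; apply: leeD.
Qed.

Lemma Jspace_tail :
  eq_nspace (Jspace q A `]0, +oo[ X0 S) (Jspace q A `]1, +oo[ X0 S).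
Proof.
have [C C0 hC] := tail_representation.
have le01 f : (nrm (Jspace q A I0 X0 S) f <= nrm (Jspace q A I1 X0 S) f)%E.
  exact: Jspace_extend0.
have le10 f : (nrm (Jspace q A I1 X0 S) f <= C%:E * nrm (Jspace q A I0 X0 S) f)%E.
  by apply: le_scaled_ereal_inf => // _ [u repu <-]; exact: hC.
split.
  apply/seteqP; split => f [Tf Nf]; split => //.
    by apply: (le_lt_trans (le10 f)); rewrite lte_mul_pinfty// lee_fin ltW.
  exact: (le_lt_trans (le01 f)).
exists 1, C; split => // f _; split; last exact: le10.
by rewrite mul1e; exact: le01.
Qed.

End J_spaces_tail.

(** * The theorem *)

(** $B$ agrees with $b$ on $[1,\infty)$ and is dominated by $\beta$ on $(0,1)$. *)
Lemma glued_tail_lt_pinfty {R : realType} (q : R) (b beta B : R -> R) (x : R) :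
  1 <= q -> 0 < x -> slowly_varying beta -> slowly_varying b -> slowly_varying B ->
  (\int[completed_lebesgue_measure]_(t in (`]0%R, +oo[%classic : set (lebesgueTypeR R)))
     ((t : R)^-1 * b t `^ q)%:E < +oo)%E ->
  (\int[completed_lebesgue_measure]_(t in (`]x, +oo[%classic : set (lebesgueTypeR R)))
     ((t : R)^-1 * beta t `^ q)%:E < +oo)%E ->
  (forall t : R, 1 <= t -> B t = b t) -> equiv_on `]0, 1[ B beta ->
  (\int[completed_lebesgue_measure]_(t in (`]x, +oo[%classic : set (lebesgueTypeR R)))
     ((t : R)^-1 * B t `^ q)%:E < +oo)%E.
Proof.
move=> q1 x0 svbeta svb svB ib ibeta Bb [c [C [c0 C0 Bbeta]]].
set mu := completed_lebesgue_measure.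
have q0 : 0 <= q by apply: le_trans q1.
pose I1 : set (lebesgueTypeR R) := `]x, 1[%classic.
pose I2 : set (lebesgueTypeR R) := `[1, +oo[%classic.
have f0 (v : R -> R) (t : R) : 0 < t -> (0 <= (t^-1 * v t `^ q)%:E)%E.
  by move=> t0; rewrite lee_fin; exact: density_ge0.
have I1x t : I1 t -> x < t /\ t < 1 by rewrite /I1/= in_itv/= => /andP[].
have I2x t : I2 t -> 1 <= t by rewrite /I2/= in_itv/= andbT.
have pos1 t : I1 t -> 0 < t by move=> /I1x[xt _]; exact: lt_trans xt.
have pos2 t : I2 t -> 0 < t by move=> /I2x; exact: lt_le_trans.
have sub : (`]x, +oo[%classic : set (lebesgueTypeR R)) `<=` I1 `|` I2.
  move=> t; rewrite /I1 /I2/= !in_itv/= !andbT => xt.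
  by case: (ltP t 1) => t1; [left; rewrite xt|right].
apply: (le_lt_trans (ge0_integral_subset mu _ (I1 `|` I2) _ sub _)).
  by move=> t [/pos1|/pos2]; exact: f0.
apply: (le_lt_trans (ge0_integral_setU_le mu I1 I2 _ _ _ _)).
- exact: itv_lebesgue_measurable.
- exact: itv_lebesgue_measurable.
- by move=> t [/pos1|/pos2]; exact: f0.
apply: lte_add_pinfty; last first.
  rewrite (eq_integral (fun t : lebesgueTypeR R => ((t : R)^-1 * b t `^ q)%:E)).
    apply: le_lt_trans ib; apply: ge0_integral_subset.
      by move=> t /pos2; rewrite /= in_itv/= andbT.
    by move=> t /=; rewrite in_itv/= andbT; exact: f0.
  by move=> t; rewrite inE => /I2x t1; rewrite Bb.
apply: (@le_lt_trans _ _ (\int[mu]_(t in I1) ((c `^ q)%:E *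
    ((t : R)^-1 * beta t `^ q)%:E))%E).
  apply: le_ge0_integral => t It; have t0 := pos1 _ It; first exact: f0.
  have [_ t1] := I1x _ It.
  have t01 : (`]0, 1[%classic : set R) t by rewrite /= in_itv/= t0.
  have [Bt _] := Bbeta t t01.
  rewrite -EFinM lee_fin mulrCA; apply: ler_wpM2l; first by rewrite invr_ge0 ltW.
  have b0 : 0 < beta t by case: svbeta => + _ _; exact.
  rewrite -powRM; [|exact: ltW|exact: ltW].
  apply: ge0_ler_powR => //; rewrite nnegrE.
    by case: svB => + _ _ => /(_ _ t0) /ltW.
  by rewrite mulr_ge0// ltW.
rewrite ge0_integralZl_EFin; first last.
- exact: powR_ge0.
- apply/measurable_EFinP; apply: measurable_funS (measurable_density _ svbeta q).
    exact: itv_lebesgue_measurable.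
  by move=> t /pos1; rewrite /= in_itv/= andbT.
- by move=> t /pos1; exact: f0.
- exact: itv_lebesgue_measurable.
apply: lte_mul_pinfty; [by rewrite lee_fin powR_ge0|by []|].
apply: le_lt_trans ibeta; apply: ge0_integral_subset.
  by move=> t /I1x[xt _]; rewrite /= in_itv/= andbT.
move=> t /=; rewrite in_itv/= andbT => xt; apply: f0; exact: lt_trans xt.
Qed.
(* 1/q' is written 1 - q^-1, so q/q' is q * (1 - q^-1). *)
Theorem mainTheorem3 (R : realType)
  (Z : topologicalLmodType R) (hZ : hausdorff_space Z)
  (E0 E1 : completeNormedModType R)
  (i0 : {linear E0 -> Z}) (i1 : {linear E1 -> Z})
  (i0_inj : injective i0) (i0_cont : continuous i0)
  (i1_inj : injective i1) (i1_cont : continuous i1)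
  (q : R) (hq : 1 <= q)
  (b : R -> R) (hb : slowly_varying b)
  (hb_int : (\int[completed_lebesgue_measure]_(t in (`]0%R, +oo[ : set (lebesgueTypeR R)))
               ((t : R)^-1 * b t `^ q)%:E < +oo)%E)
  (beta : R -> R) (hbeta : slowly_varying beta)
  (hbeta_fin : forall x : R, 0 < x ->
     (\int[completed_lebesgue_measure]_(t in (`]x, +oo[ : set (lebesgueTypeR R)))
        ((t : R)^-1 * beta t `^ q)%:E < +oo)%E)
  (hbeta_inf : (\int[completed_lebesgue_measure]_(t in (`]0%R, +oo[ : set (lebesgueTypeR R)))
                  ((t : R)^-1 * beta t `^ q)%:E = +oo)%E)
  (B : R -> R) (hB : slowly_varying B)
  (hB_b : forall x : R, 1 <= x -> B x = b x)
  (hB_beta : equiv_on `]0, 1[ B beta)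
  (A : R -> R)
  (hA : forall x : R, 0 < x ->
     A x = B x `^ (- (q * (1 - q^-1))) *
           fine (\int[completed_lebesgue_measure]_(t in (`]x, +oo[ : set (lebesgueTypeR R)))
                   ((t : R)^-1 * B t `^ q)%:E)%E) :
  let X0 := embedded_space i0 in
  let X1 := embedded_space i1 in
  [/\ eq_nspace (Kspace q b `]0, +oo[ X0 X1)
                (Kspace q b `]1, +oo[ X0 X1),
      eq_nspace (Kspace q B `]0, +oo[ X0 (sum_space X0 X1))
                (Kspace q B `]1, +oo[ X0 (sum_space X0 X1))
    & eq_nspace (Jspace q A `]0, +oo[ X0 (sum_space X0 X1))
                (Jspace q A `]1, +oo[ X0 (sum_space X0 X1))].
Proof.
move=> X0 X1.
have q0 : 0 <= q by apply: le_trans hq.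
have s0 : seminormed X0 by exact: embedded_seminormed.
have s1 : seminormed X1 by exact: embedded_seminormed.
have sS : seminormed (sum_space X0 X1) by exact: sum_seminormed.
have itv01 : (`]0%R, 1%R]%classic : set (lebesgueTypeR R)) `<=` `]0%R, +oo[%classic.
  by move=> t /=; rewrite !in_itv/= andbT => /andP[].
have itv1y : (`]1%R, +oo[%classic : set (lebesgueTypeR R)) `<=` `]0%R, +oo[%classic.
  by move=> t /=; rewrite !in_itv/= !andbT; exact: lt_trans.
have m0y : measurable (`]0%R, +oo[%classic : set (lebesgueTypeR R)).
  exact: itv_lebesgue_measurable.
have tail_fin (x : R) : 0 < x ->
    (\int[completed_lebesgue_measure]_(t in (`]x, +oo[%classic : set (lebesgueTypeR R)))
     ((t : R)^-1 * B t `^ q)%:E < +oo)%E.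
  move=> x0; apply: (glued_tail_lt_pinfty q b beta B x hq x0 hbeta hb hB hb_int _ hB_b hB_beta).
  exact: hbeta_fin.
have pos (v : R -> R) : slowly_varying v -> forall t, 0 < t -> 0 < v t by case.
split.
- apply: (Kspace_tail q b (fun=> 1) X0 X1 hq s0 s1 (pos _ hb)).
  + by move=> t _; exact: ler01.
  + rewrite (_ : (fun t => _) = fun t : lebesgueTypeR R => t^-1 * b t `^ q).
      exact: (measurable_funS m0y itv01 (measurable_density _ hb q)).
    by apply/funext => t; rewrite mulr1.
  + exact: (measurable_funS m0y itv1y (measurable_density _ hb q)).
  + rewrite (eq_integral (fun t : lebesgueTypeR R => ((t : R)^-1 * b t `^ q)%:E)).
      apply: le_lt_trans hb_int; apply: ge0_integral_subset; first exact: itv01.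
      by move=> t /=; rewrite in_itv/= andbT => t0; rewrite lee_fin; exact: density_ge0.
    by move=> t _; rewrite mulr1.
  + exact: integral_density_gt0.
  + by move=> f t _ /andP[_ t1]; rewrite mul1e; exact: Kfun_homo.
- apply: (Kspace_tail q B id X0 (sum_space X0 X1) hq s0 sS (pos _ hB)).
  + by move=> t /ltW.
  + apply: (measurable_funS m0y itv01); apply: (measurable_powR_density (fun t => B t * t)).
    apply: measurable_funM; first by case: hB.
    apply: (borel_lebesgue_measurable_fun _ _ `]0%R, +oo[%classic (fun t : R => t)).
      exact: measurable_itv.
    exact: measurable_id.
  + exact: (measurable_funS m0y itv1y (measurable_density _ hB q)).
  + exact: integral_linear_weight.
  + exact: integral_density_gt0.
  + by move=> f t Yf /andP[t0 _]; apply: Kfun_ordered_le => //; exact: ltW.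
- exact: (Jspace_tail i0 X1 B A q i0_inj s1 hB hq tail_fin hA).
Qed.
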